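(* Let $(\Omega,\mathcal{F},\mathbb{P})$ be a nonatomic probability space and let $(\Phi,\Psi)$ be an Orlicz pair as in the context. Let $\rho:L^\infty\to(-\infty,\infty]$ be a proper, convex, law-invariant functional with the Fatou property on $L^\infty$ (equivalently, norm lower semicontinuous on $L^\infty$). Then $\rho$ admits a unique extension $\rho':L^\Phi\to(-\infty,\infty]$ (i.e. $\rho'=\rho$ on $L^\infty$) which is proper, convex, law-invariant, and has the Fatou property on $L^\Phi$.
   Context: $(\Omega,\mathcal{F},\mathbb{P})$ is a nonatomic probability space; random variables are identified up to a.s. equality. An Orlicz function is a convex, increasing $\Phi:[0,\infty)\to[0,\infty)$ with $\Phi(0)=0$; its conjugate is $\Psi(s)=\sup_{t\ge0}(ts-\Phi(t))$. Standing assumption: $\Phi(t)>0$ for $t>0$ and $\lim_{t\to\infty}\Phi(t)/t=\infty$. $L^\Phi$ is the space of random variables $X$ with $\|X\|_\Phi:=\inf\{\lambda>0:\mathbb{E}[\Phi(|X|/\lambda)]\le 1\}<\infty$; $L^\infty\subset L^\Phi$. Proper: not identically $\infty$. Law-invariant: $\rho(X)=\rho(Y)$ whenever $X,Y$ have the same law. For $E\in\{L^\infty,L^\Phi\}$, a functional on $E$ has the Fatou property on $E$ if whenever $X_n,X\in E$, $X_n\to X$ a.s. and $|X_n|\le Y$ for some $Y\in E$ and all $n$, then $\rho(X)\le\liminf_n\rho(X_n)$. *)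

(* Defs.v *)
From HB Require Import structures.
From mathcomp Require Import all_boot all_order all_algebra.
From mathcomp Require Import all_classical all_reals all_analysis.
Set Implicit Arguments. Unset Strict Implicit. Unset Printing Implicit Defensive.
Import Order.TTheory GRing.Theory Num.Theory.
Import numFieldNormedType.Exports.
Local Open Scope classical_set_scope.
Local Open Scope ring_scope.

Section orlicz_defs.
Context (R : realType).

(* Orlicz function Phi : [0,oo) -> [0,oo) (values on negative reals are
   irrelevant), together with the standing assumptions. *)
Definition orlicz_function (Phi : R -> R) : Prop :=
  [/\ Phi 0 = 0,
      (forall t, 0 <= t -> 0 <= Phi t),
      (forall s t, 0 <= s -> s <= t -> Phi s <= Phi t),
      (forall s t l, 0 <= s -> 0 <= t -> 0 <= l <= 1 ->
          Phi (l * s + (1 - l) * t) <= l * Phi s + (1 - l) * Phi t) &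
      (forall t, 0 < t -> 0 < Phi t)].

Definition orlicz_superlinear (Phi : R -> R) : Prop :=
  (fun t => Phi t / t) x @[x --> +oo] --> +oo.

End orlicz_defs.

Section rv_defs.
Context (d : measure_display) (T : measurableType d) (R : realType)
  (P : probability T R).

Definition nonatomic : Prop :=
  forall A : set T, measurable A -> (0 < P A)%E ->
    exists B : set T, [/\ measurable B, B `<=` A, (0 < P B)%E & (P B < P A)%E].

Definition random_variable (X : T -> R) : Prop := measurable_fun setT X.

Definition Linfty (X : T -> R) : Prop :=
  random_variable X /\ exists c : R, {ae P, forall x, `|X x| <= c}.

(* L^Phi : random variables with finite Luxemburg norm, i.e. there is
   lambda > 0 with E[Phi(|X|/lambda)] <= 1 *)
Definition LPhi (Phi : R -> R) (X : T -> R) : Prop :=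
  random_variable X /\
  exists l : R, 0 < l /\ (\int[P]_x (Phi (`|X x| / l))%:E <= 1)%E.

Definition same_law (X Y : T -> R) : Prop :=
  forall B : set R, measurable B -> P (X @^-1` B) = P (Y @^-1` B).

(* properties of a functional rho on the space E (E a predicate on T -> R);
   only the values on E matter *)
Definition proper_on (E : (T -> R) -> Prop) (rho : (T -> R) -> \bar R) : Prop :=
  (forall X, E X -> rho X != -oo%E) /\ (exists X, E X /\ (rho X < +oo)%E).

Definition convex_on (E : (T -> R) -> Prop) (rho : (T -> R) -> \bar R) : Prop :=
  forall X Y (l : R), E X -> E Y -> 0 <= l <= 1 ->
    (rho (fun x => (l * X x + (1 - l) * Y x)%R)
       <= l%:E * rho X + (1 - l)%:E * rho Y)%E.

Definition law_invariant_on (E : (T -> R) -> Prop)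
    (rho : (T -> R) -> \bar R) : Prop :=
  forall X Y, E X -> E Y -> same_law X Y -> rho X = rho Y.

Definition fatou_on (E : (T -> R) -> Prop) (rho : (T -> R) -> \bar R) : Prop :=
  forall (Xn : nat -> T -> R) (X Y : T -> R),
    (forall n, E (Xn n)) -> E X -> E Y ->
    {ae P, forall x, (fun n => Xn n x) @ \oo --> X x} ->
    (forall n, {ae P, forall x, `|Xn n x| <= Y x}) ->
    (rho X <= limn_einf (fun n => rho (Xn n)))%E.

End rv_defs.

(* Main.v *)
Require Import Defs.
From HB Require Import structures.
From mathcomp Require Import all_boot all_order all_algebra.
From mathcomp Require Import all_classical all_reals all_analysis.
From mathcomp Require Import measurable_realfun.
From mathcomp Require Import ring lra.
Set Implicit Arguments. Unset Strict Implicit. Unset Printing Implicit Defensive.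
Import Order.TTheory GRing.Theory Num.Theory.
Import numFieldNormedType.Exports.
Local Open Scope classical_set_scope.
Local Open Scope ring_scope.

(** Averaging over cells.  For measurable sets A_0, ..., A_(n-1) covering the
    space, let L replace X successively on each A_k by its mean there.  L is
    linear and maps L^1 continuously into L^oo.  The extension is
    rho' X = sup_L rho (L X).

    Dilatation monotonicity: rho (L X) <= rho X for rho convex, law-invariant
    and Fatou on L^oo or on L^Phi.  It suffices to treat one cell A.  Under
    P(. | A), which is nonatomic, there is a uniform variable U, and X can be
    rearranged on A as g (U) with g its quantile function.  All the shifts
    g (U + i/N mod 1) have the law of X and their mean over i < N is close to
    the mean of X: uniformly for the truncation of g, because g is monotone,
    and in Phi-modular for the tail, by convexity.  Fast Phi-modular
    convergence implies a.s. convergence dominated in L^Phi, so that the Fatou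
    property applies.

    If the cells are level sets of X of small diameter together with a tail
    {|X| >= M}, then L X is Phi-modular close to X, by Jensen's inequality on
    the tail.  Hence rho' = rho on L^oo, and any extension rho'' satisfies
    rho'' X <= liminf rho (L_n X) <= rho' X, the converse inequality being
    dilatation monotonicity for rho''.  The Fatou property of rho' holds because
    dominated convergence is L^1 convergence and L is continuous from L^1 to
    L^oo; law-invariance follows since the law of L X depends only on that of X
    for level-set cells. *)

(** * Orlicz functions and Orlicz classes *)

Section orlicz.
Context (d : measure_display) (T : measurableType d) (R : realType)
  (P : probability T R) (Phi : R -> R) (hPhi : orlicz_function Phi).
Implicit Types (X Y Z : T -> R) (l s t : R).

Lemma orlicz_0 : Phi 0 = 0. Proof. by case: hPhi. Qed.

Lemma orlicz_ge0 t : 0 <= t -> 0 <= Phi t. Proof. by case: hPhi => _ + _ _ _; apply. Qed.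

Lemma orlicz_le s t : 0 <= s -> s <= t -> Phi s <= Phi t.
Proof. by case: hPhi => _ _ + _ _; apply. Qed.

Lemma orlicz_gt0 t : 0 < t -> 0 < Phi t. Proof. by case: hPhi => _ _ _ _; apply. Qed.

Lemma orlicz_convex s t l : 0 <= s -> 0 <= t -> 0 <= l <= 1 ->
  Phi (l * s + (1 - l) * t) <= l * Phi s + (1 - l) * Phi t.
Proof. by case: hPhi => _ _ _ + _; apply. Qed.

Lemma orlicz_scale l t : 0 <= l <= 1 -> 0 <= t -> Phi (l * t) <= l * Phi t.
Proof.
move=> l01 t0; have := orlicz_convex t0 (lexx 0) l01.
by rewrite orlicz_0 !mulr0 !addr0.
Qed.

Lemma orlicz_mean2 s t : 0 <= s -> 0 <= t ->
  Phi ((s + t) / 2) <= (Phi s + Phi t) / 2.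
Proof.
move=> s0 t0; have h : 0 <= (2^-1 : R) <= 1 by lra.
have := orlicz_convex s0 t0 h.
by rewrite (_ : 2^-1 * s + (1 - 2^-1) * t = (s + t) / 2); lra.
Qed.

Lemma measurable_orlicz l X : 0 <= l -> measurable_fun setT X ->
  measurable_fun setT (fun x => Phi (`|X x| / l)).
Proof.
move=> l0 mX.
(* [Phi] is monotone only on [0, +oo[; precomposed with the positive part it is monotone on the
   whole line, hence measurable. *)
pose Phi0 (t : R) := Phi (Num.max 0 t).
rewrite (_ : (fun x => _) = Phi0 \o (fun x => `|X x| / l)).
  apply: measurableT_comp; last first.
    apply: measurable_funM => //; exact: measurableT_comp.
  apply: nondecreasing_measurable => // s t st; rewrite /Phi0.
  apply: orlicz_le; first by rewrite le_max lexx.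
  by rewrite ge_max le_max lexx /= le_max st orbT.
by apply/funext => x /=; rewrite /Phi0 max_r// divr_ge0.
Qed.

Lemma measurable_orliczE l X : 0 <= l -> measurable_fun setT X ->
  measurable_fun setT (fun x => (Phi (`|X x| / l))%:E).
Proof. by move=> l0 mX; apply/measurable_EFinP; exact: measurable_orlicz. Qed.

Lemma orlicz_norm_ge0 l (r : R) : 0 <= l -> 0 <= Phi (`|r| / l).
Proof. by move=> l0; rewrite orlicz_ge0// divr_ge0. Qed.

Lemma LPhi_le X Y : measurable_fun setT X -> LPhi P Phi Y ->
  {ae P, forall x, `|X x| <= Y x} -> LPhi P Phi X.
Proof.
move=> mX [mY [l [l0 Yl]]] XY; split => //; exists l; split => //.
apply: le_trans Yl; apply: ae_ge0_le_integral => //.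
- by move=> x _; rewrite lee_fin orlicz_norm_ge0// ltW.
- by apply: measurable_orliczE => //; exact: ltW.
- by move=> x _; rewrite lee_fin orlicz_norm_ge0// ltW.
- by apply: measurable_orliczE => //; exact: ltW.
- apply: filterS XY => x XYx _; rewrite lee_fin orlicz_le//.
    by rewrite divr_ge0// ltW.
  by rewrite ler_pM2r ?invr_gt0// (le_trans XYx)// ler_norm.
Qed.

(** As in the triangle inequality for the Luxemburg norm, the scales add: |X + Y| / (a + b) is at
    most the convex combination of |X| / a and |Y| / b with weights a / (a + b) and b / (a + b). *)
Lemma LPhi_add X Y : LPhi P Phi X -> LPhi P Phi Y ->
  LPhi P Phi (fun x => X x + Y x).
Proof.
move=> [mX [a [a0 Xa]]] [mY [b [b0 Yb]]]; split; first exact: measurable_funD.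
have ab0 : 0 < a + b by exact: addr_gt0.
exists (a + b); split => //.
pose c := a / (a + b).
have c01 : 0 <= c <= 1.
  apply/andP; split; first by rewrite divr_ge0// ltW.
  by rewrite ler_pdivrMr// mul1r lerDl ltW.
have c1 : 1 - c = b / (a + b) by rewrite /c; field; rewrite gt_eqF.
apply: (@le_trans _ _ (\int[P]_x (c%:E * (Phi (`|X x| / a))%:E +
    (1 - c)%:E * (Phi (`|Y x| / b))%:E))%E).
  apply: ge0_le_integral => //.
  - by move=> x _; rewrite lee_fin orlicz_norm_ge0// ltW.
  - by apply: measurable_orliczE; [exact: ltW|exact: measurable_funD].
  - apply: emeasurable_funD; apply: measurable_funeM; apply: measurable_orliczE => //; exact: ltW.
  - move=> x _; rewrite -!EFinM -EFinD lee_fin.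
    apply: le_trans (orlicz_convex _ _ c01); rewrite ?divr_ge0 ?(ltW a0) ?(ltW b0)//.
    apply: orlicz_le; first by rewrite divr_ge0 ?(ltW ab0).
    rewrite c1 /c [leRHS](_ : _ = (`|X x| + `|Y x|) / (a + b)).
      by rewrite ler_pM2r ?invr_gt0// ler_normD.
    by field; rewrite !gt_eqF.
have [c0 c0'] : 0 <= c /\ 0 <= 1 - c by move/andP : c01 => [? ?]; split => //; rewrite subr_ge0.
rewrite ge0_integralD//; last 4 first.
- by move=> x _; rewrite mule_ge0 ?lee_fin ?orlicz_norm_ge0// ltW.
- by apply: measurable_funeM; apply: measurable_orliczE => //; exact: ltW.
- by move=> x _; rewrite mule_ge0 ?lee_fin ?orlicz_norm_ge0// ltW.
- by apply: measurable_funeM; apply: measurable_orliczE => //; exact: ltW.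
rewrite !ge0_integralZl_EFin//; last 4 first.
- by move=> x _; rewrite lee_fin orlicz_norm_ge0// ltW.
- by apply: measurable_orliczE => //; exact: ltW.
- by move=> x _; rewrite lee_fin orlicz_norm_ge0// ltW.
- by apply: measurable_orliczE => //; exact: ltW.
rewrite (_ : 1%E = c%:E * 1 + (1 - c)%:E * 1)%E.
  by apply: leeD; rewrite lee_wpmul2l// lee_fin.
by rewrite !mule1 -EFinD; congr (_%:E); lra.
Qed.

Lemma LPhi_cst (c : R) : LPhi P Phi (cst c).
Proof.
split; first exact: measurable_cst.
(* The scale makes both K and K * Phi 1 at most l, so that Phi (K / l) <= K * Phi 1 / l <= 1 by
   convexity. *)
pose K := `|c|; pose l := K + K * Phi 1 + 1.
have P1 : 0 <= Phi 1 by exact: orlicz_ge0.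
have K0 : 0 <= K by exact: normr_ge0.
have KP : 0 <= K * Phi 1 by exact: mulr_ge0.
have l0 : 0 < l by rewrite /l; lra.
exists l; split => //.
have e : (\int[P]_x (Phi (`|cst c x| / l))%:E = (Phi (K / l))%:E)%E.
  by have := integral_cst P measurableT (Phi (K / l))%:E; rewrite /= probability_setT mule1.
rewrite e lee_fin.
have := @orlicz_scale (K / l) 1; rewrite mulr1 => /(_ _ ler01).
have -> : 0 <= K / l <= 1.
  apply/andP; split; first by rewrite divr_ge0// ltW.
  by rewrite ler_pdivrMr// mul1r /l; lra.
move=> /(_ isT)/le_trans; apply.
by rewrite mulrAC ler_pdivrMr// mul1r /l; lra.
Qed.

Lemma Linfty_LPhi X : Linfty P X -> LPhi P Phi X.
Proof. by move=> [mX [c Xc]]; apply: LPhi_le (LPhi_cst c) _. Qed.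

Lemma LPhi_norm X : LPhi P Phi X -> LPhi P Phi (fun x => `|X x|).
Proof.
move=> [mX [l [l0 Xl]]]; split; first exact: measurableT_comp.
by exists l; split => //; under eq_integral do rewrite normr_id.
Qed.

Lemma LPhi_scale (c : R) X : LPhi P Phi X -> LPhi P Phi (fun x => c * X x).
Proof.
move=> [mX [l [l0 Xl]]]; split.
  by apply: measurable_funM => //; exact: measurable_cst.
have c1 : 0 < `|c| + 1 by have := normr_ge0 c; lra.
exists (l * (`|c| + 1)); split; first exact: mulr_gt0.
apply: le_trans Xl; apply: ge0_le_integral => //.
- by move=> x _; rewrite lee_fin orlicz_norm_ge0// ltW// mulr_gt0.
- apply: measurable_orliczE; first by rewrite ltW// mulr_gt0.
  by apply: measurable_funM => //; exact: measurable_cst.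
- by apply: measurable_orliczE => //; exact: ltW.
- move=> x _; rewrite lee_fin orlicz_le//.
    by rewrite divr_ge0// ltW// mulr_gt0.
  rewrite normrM [X in X <= _](_ : _ = (`|c| / (`|c| + 1)) * (`|X x| / l)); last first.
    by field; rewrite !gt_eqF.
  rewrite ler_piMl//; first by rewrite divr_ge0// ltW.
  by rewrite ler_pdivrMr// mul1r lerDl.
Qed.

(** For s = t / l beyond 1, convexity and Phi 0 = 0 give s * Phi 1 <= Phi s. This yields the
    inclusion of L^Phi in L^1 and turns modular bounds into pointwise ones. *)
Lemma orlicz_linear_bound (l t : R) : 0 < l -> 0 <= t ->
  t <= l * (1 + Phi (t / l) / Phi 1).
Proof.
move=> l0 t0; have P1 := orlicz_gt0 (@ltr01 R).
rewrite -ler_pdivrMl// mulrC; set s := t / l.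
have s0 : 0 <= s by rewrite divr_ge0// ltW.
have Ps0 : 0 <= Phi s / Phi 1 by apply: divr_ge0; [exact: orlicz_ge0|exact: ltW].
have [s1|s1] := leP s 1; first by rewrite (le_trans s1)// lerDl.
suff : s <= Phi s / Phi 1 by move=> /le_trans; apply; rewrite lerDr.
rewrite ler_pdivlMr//.
have s0' : 0 < s by exact: lt_trans s1.
have := @orlicz_scale s^-1 s; rewrite mulVf ?gt_eqF//.
by rewrite invr_ge0 s0 invf_le1//= ltW// => /(_ isT isT); rewrite ler_pdivlMl.
Qed.

Lemma LPhi_integrable X : LPhi P Phi X -> P.-integrable setT (EFin \o X).
Proof.
move=> [mX [l [l0 Xl]]]; apply/integrableP; split; first exact/measurable_EFinP.
have P1 : 0 < Phi 1 by exact: orlicz_gt0.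
apply: (@le_lt_trans _ _ (\int[P]_x (l%:E + (l / Phi 1)%:E * (Phi (`|X x| / l))%:E))%E).
  apply: ge0_le_integral => //.
  - by apply: measurableT_comp => //; exact/measurable_EFinP.
  - apply: emeasurable_funD => //; apply: measurable_funeM; apply: measurable_orliczE => //; exact: ltW.
  - move=> x _ /=; rewrite lee_fin.
    rewrite (le_trans (orlicz_linear_bound l0 (normr_ge0 _)))//.
    by rewrite mulrDr mulr1 mulrA mulrAC.
rewrite ge0_integralD//; last 3 first.
- by move=> x _; rewrite lee_fin ltW.
- by move=> x _; rewrite mule_ge0 ?lee_fin ?divr_ge0 ?orlicz_norm_ge0// ltW.
- by apply: measurable_funeM; apply: measurable_orliczE => //; exact: ltW.
rewrite ge0_integralZl_EFin//; last 3 first.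
- by move=> x _; rewrite lee_fin orlicz_norm_ge0// ltW.
- by apply: measurable_orliczE => //; exact: ltW.
- by rewrite divr_ge0// ltW.
rewrite integral_cst//= probability_setT mule1 lte_add_pinfty ?ltry//.
rewrite lte_mul_pinfty ?lee_fin ?divr_ge0 ?ltW//.
by rewrite (le_lt_trans Xl)// ltry.
Qed.

End orlicz.

Section liminf.
Context (R : realType).
Implicit Types u v : nat -> \bar R.
Local Open Scope ereal_scope.

Lemma le_limn_einf u v : (forall n, u n <= v n) -> limn_einf u <= limn_einf v.
Proof.
move=> uv; rewrite !limn_einf_lim; apply: lee_lim; [exact: is_cvg_einfs..|].
apply: nearW => n; apply: le_ereal_inf_tmp => _ [k /= nk <-].
by apply: le_trans (uv k); apply: ereal_inf_lbound; exists k.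
Qed.

Lemma limn_einf_le u (c : \bar R) : (forall n, u n <= c) -> limn_einf u <= c.
Proof.
move=> uc; apply: (@le_trans _ _ (limn_einf (fun=> c))); first exact: le_limn_einf.
by have [-> _] := cvg_limn_einf_sup (@cvg_cst _ c _ \oo _).
Qed.

End liminf.

(** * Fast modular convergence implies dominated a.s. convergence *)

Section modular_convergence.
Context (d : measure_display) (T : measurableType d) (R : realType)
  (P : probability T R) (Phi : R -> R) (hPhi : orlicz_function Phi).

(** Since [Phi] is positive off 0, Phi (e / l) can serve as threshold, and falling below it forces u
    n < e by monotonicity. *)
Lemma orlicz_cvg0 (l : R) (u : nat -> R) : 0 < l -> (forall n, 0 <= u n) ->
  (Phi (u n / l) @[n --> \oo] --> 0) -> u n @[n --> \oo] --> 0.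
Proof.
move=> l0 u0 /cvgr0Pnorm_lt Pu; apply/cvgr0Pnorm_lt => e e0.
have el : 0 < e / l by exact: divr_gt0.
have := Pu _ (orlicz_gt0 hPhi el); apply: filterS => n.
have ul : 0 <= u n / l by rewrite divr_ge0// ltW.
rewrite (ger0_norm (orlicz_ge0 hPhi ul)) ger0_norm//.
rewrite !ltNge; apply: contra => eu.
apply: orlicz_le => //; first exact: ltW.
by rewrite ler_pM2r// invr_gt0.
Qed.

(** The sum [h] of the modular densities has integral at most 1, so it is a.s. finite and its terms
    tend to 0. It also controls S = sup_n |Z_n - X| at the scale 2 l, so |X| + S is a majorant in
    L^Phi. *)
Lemma modular_dominated_cvg (l : R) (Z : nat -> T -> R) (X : T -> R) :
  0 < l -> (forall n, measurable_fun setT (Z n)) -> LPhi P Phi X ->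
  (forall n, \int[P]_x (Phi (`|Z n x - X x| / l))%:E <= (1 / (2 ^ n.+1)%:R)%:E)%E ->
  {ae P, forall x, (fun n => Z n x) @ \oo --> X x} /\
  exists Y, LPhi P Phi Y /\ forall n, {ae P, forall x, `|Z n x| <= Y x}.
Proof.
move=> l0 mZ LX Zle; have mX : measurable_fun setT X by case: LX.
pose u n x := `|Z n x - X x|.
have mZX n : measurable_fun setT (fun x => Z n x - X x) by exact: measurable_funB.
pose f n x := (Phi (u n x / l))%:E.
have f0 n x : (0 <= f n x)%E by rewrite lee_fin orlicz_norm_ge0// ltW.
have mf n : measurable_fun setT (f n) by apply: measurable_orliczE => //; exact: ltW.
pose h x := (\big[+%E/0%R]_(0 <= n <oo) f n x)%E.
have h0 x : (0 <= h x)%E by exact: nneseries_ge0.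
have mh : measurable_fun setT h by exact: ge0_emeasurable_sum.
have ih : (\int[P]_x h x <= 1)%E.
  rewrite integral_nneseries//; apply: le_trans (epsilon_trick0 xpredT ler01).
  by apply: lee_nneseries => [n _ _|n _]; [exact: integral_ge0|exact: Zle].
have hfin : {ae P, forall x, h x \is a fin_num}.
  have : P.-integrable setT h.
    apply/integrableP; split => //.
    by under eq_integral do rewrite gee0_abs//; rewrite (le_lt_trans ih)// ltry.
  by move/(integrable_ae measurableT); apply: filterS => x; apply.
have fh n x : (f n x <= h x)%E.
  apply: le_trans (nneseries_lim_ge n.+1 _); last by move=> *; exact: f0.
  by rewrite big_nat_recr//= leeDr// sume_ge0.
have ucvg x : h x \is a fin_num -> u n x @[n --> \oo] --> 0.
  move=> hx; apply: (orlicz_cvg0 l0) => //; first by move=> n; exact: normr_ge0.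
  apply: cvg_series_cvg_0; apply: nnseries_is_cvg => [n|].
    by rewrite orlicz_norm_ge0// ltW.
  by move: hx; rewrite ge0_fin_numE.
(* [fine] keeps [S] real-valued: it sends an infinite supremum to 0, which can occur only where [h]
   is infinite, hence on a null set. *)
pose S x := fine (esups (fun n => (u n x)%:E) 0%N).
have mS : measurable_fun setT S.
  apply: measurableT_comp; first exact: fine_measurable.
  by apply: measurable_fun_esups => n; apply/measurable_EFinP; exact: measurableT_comp.
have SE x : h x \is a fin_num -> (S x)%:E = esups (fun n => (u n x)%:E) 0%N.
  move=> hx; rewrite fineK// ge0_fin_numE; last first.
    by apply: (@le_trans _ _ (u 0%N x)%:E); [rewrite lee_fin normr_ge0|apply: ereal_sup_ubound; exists 0%N].
  apply: (@le_lt_trans _ _ (l * (1 + fine (h x) / Phi 1))%:E); last exact: ltry.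
  apply: ge_ereal_sup => _ [n _ <-]; rewrite lee_fin.
  apply: le_trans (orlicz_linear_bound hPhi l0 (normr_ge0 _)) _.
  rewrite ler_pM2l// lerD2l ler_pM2r ?invr_gt0 ?orlicz_gt0//.
  by rewrite -lee_fin fineK// fh.
have uS n x : h x \is a fin_num -> u n x <= S x.
  by move=> hx; rewrite -lee_fin SE//; apply: ereal_sup_ubound; exists n.
have S0 x : h x \is a fin_num -> 0 <= S x.
  by move=> hx; apply: le_trans (uS 0%N _ hx); exact: normr_ge0.
have LS : LPhi P Phi S.
  split => //; exists (2 * l); split; first exact: mulr_gt0.
  apply: le_trans ih; apply: ae_ge0_le_integral => //.
  - by move=> x _; rewrite lee_fin orlicz_norm_ge0// mulr_ge0// ltW.
  - by apply: measurable_orliczE => //; rewrite mulr_ge0// ltW.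
  - apply: filterS hfin => x hx _; rewrite ger0_norm ?S0//.
    have [S00|Sgt0] := eqVneq (S x) 0; first by rewrite S00 mul0r orlicz_0.
    have {}Sgt0 : 0 < S x by rewrite lt_neqAle eq_sym Sgt0 S0.
    (* The supremum need not be attained, but some term exceeds half of it; hence the scale 2 l. *)
    have : ((S x / 2)%:E < esups (fun n => (u n x)%:E) 0%N)%E.
      by rewrite -SE// lte_fin; lra.
    move=> /ereal_sup_gt[_ [n _ <-]]; rewrite lte_fin => Sun.
    apply: le_trans (fh n x); rewrite lee_fin orlicz_le//.
      by rewrite divr_ge0// ?S0// mulr_ge0// ltW.
    by rewrite invfM mulrA ler_pM2r ?invr_gt0// ltW.
split.
  apply: filterS hfin => x /ucvg ux.
  apply/cvgrPdist_lt => e e0; move/cvgr0Pnorm_lt : ux => /(_ _ e0).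
  by apply: filterS => n; rewrite /u normr_id distrC.
exists (fun x => `|X x| + S x); split.
  by apply: LPhi_add => //; exact: LPhi_norm.
move=> n; apply: filterS hfin => x /(uS n) un.
rewrite -(subrKC (X x) (Z n x)) (le_trans (ler_normD _ _))//.
by rewrite lerD2l.
Qed.

End modular_convergence.

(** * Uniform variables on a nonatomic space *)

Section nonatomic_split.
Context (d : measure_display) (T : measurableType d) (R : realType)
  (Q : probability T R).
Local Notation q A := (fine (Q A)).
Implicit Types A B C : set T.

Lemma fine_prob A : measurable A -> (fine (Q A))%:E = Q A.
Proof. by move=> mA; rewrite fineK// fin_num_measure. Qed.

Lemma fprob_ge0 A : 0 <= q A.
Proof. exact: fine_ge0. Qed.

Lemma fprob_le A B : measurable A -> measurable B -> A `<=` B -> q A <= q B.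
Proof.
move=> mA mB AB; rewrite fine_le ?fin_num_measure//.
by rewrite le_measure ?inE.
Qed.

Lemma fprobD A B : measurable A -> measurable B -> B `<=` A ->
  q (A `\` B) = q A - q B.
Proof.
move=> mA mB BA; rewrite measureD//; last first.
  by have := ltry (q A); rewrite fine_prob.
by rewrite (setIidr BA) fineB// fin_num_measure.
Qed.

Lemma fprobU A B : measurable A -> measurable B -> A `&` B = set0 ->
  q (A `|` B) = q A + q B.
Proof. by move=> mA mB AB; rewrite measureU// fineD// fin_num_measure. Qed.

Lemma fprobT : q setT = 1.
Proof. by rewrite probability_setT. Qed.

Lemma fprob0 : q set0 = 0.
Proof. by rewrite measure0. Qed.

Lemma fprob_le1 A : measurable A -> q A <= 1.
Proof. by move=> mA; rewrite -fprobT fprob_le. Qed.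

Hypothesis naQ : nonatomic Q.

(** If a proper part of A has more than half of the mass, its complement in A has less than half,
    and positive mass. *)
Lemma nonatomic_half_le A : measurable A -> 0 < q A ->
  exists B, [/\ measurable B, B `<=` A, 0 < q B & q B <= q A / 2].
Proof.
move=> mA A0; have := naQ mA; rewrite -fine_prob// lte_fin => /(_ A0).
move=> [B [mB BA]]; rewrite -(fine_prob mB) -(fine_prob mA) !lte_fin => B0 BltA.
have [h|h] := leP (q B) (q A / 2); first by exists B.
exists (A `\` B); split; [exact: measurableD|exact: subDsetl| |].
  by rewrite fprobD//; lra.
by rewrite fprobD//; lra.
Qed.

Lemma nonatomic_small A (e : R) : measurable A -> 0 < q A -> 0 < e ->
  exists B, [/\ measurable B, B `<=` A, 0 < q B & q B < e].
Proof.
move=> mA A0 e0.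
have H n : exists B, [/\ measurable B, B `<=` A, 0 < q B & q B * (2 ^ n)%:R <= q A].
  elim: n => [|n [B [mB BA B0 Bn]]]; first by exists A; split => //; rewrite mulr1.
  have [C [mC CB C0 Cn]] := nonatomic_half_le mB B0.
  exists C; split => //; first exact: subset_trans BA.
  rewrite expnS natrM mulrA; apply: le_trans Bn.
  by rewrite ler_wpM2r//; lra.
(* This number n of halvings is enough because 2 ^ n >= n > q A / e. *)
have [B [mB BA B0 Bn]] := H (Num.truncn (q A / e)).+1.
exists B; split => //; set n := (Num.truncn _).+1 in Bn.
have n2 : n%:R <= (2 ^ n)%:R :> R by rewrite ler_nat ltnW// ltn_expl.
have : q A / e < n%:R by exact: truncnS_gt.
rewrite ltr_pdivrMr// => An.
have := lt_le_trans (le_lt_trans Bn An) (ler_wpM2r (ltW e0) n2).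
by rewrite mulrC ltr_pM2l// ltr0n expn_gt0.
Qed.

(** Greedy exhaustion: sets are added to C_n as large as possible, up to a factor 2, while the total
    mass stays at most t. If the union B missed t, a small set D in A \ B would remain a candidate
    forever, and every stage would add at least q D / 2, which is impossible in a probability
    space. *)
Lemma nonatomic_split A (t : R) : measurable A -> 0 <= t <= q A ->
  exists B, [/\ measurable B, B `<=` A & q B = t].
Proof.
move=> mA /andP[t0 tA].
pose good C := [/\ measurable C, C `<=` A & q C <= t].
pose cand C D := [/\ measurable D, D `<=` A `\` C & q C + q D <= t].
(* The supremum of the candidate masses may fail to be attained, so a candidate reaching half of it
   is taken; if it is 0, the empty set serves. *)
have step C : exists D, good C -> cand C D /\ forall D', cand C D' -> q D' <= 2 * q D.
  have [gC|] := pselect (good C); last by exists set0.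
  have [mC CA Ct] := gC.
  have cand0 : cand C set0 by split => //; rewrite fprob0 addr0.
  pose S := [set q D | D in cand C].
  have S0 : S !=set0 by exists (q set0), set0.
  have hS : has_sup S.
    by split => //; exists 1 => _ [D [mD _ _] <-]; exact: fprob_le1.
  have [supS0|supS0] := leP (sup S) 0.
    exists set0 => _; split => // D' cD'; rewrite fprob0 mulr0.
    by rewrite (le_trans _ supS0)//; apply: sup_upper_bound => //; exists D'.
  have [_ [D cD <-] Dsup] := sup_adherent (divr_gt0 supS0 (ltr0n _ 2)) hS.
  exists D => _; split => // D' cD'.
  have : q D' <= sup S by apply: sup_upper_bound => //; exists D'.
  by move: Dsup; lra.
have [g gP] := choice step.
pose C n := iter n (fun C => C `|` g C) set0.
have gC n : good (C n).
  elim: n => [|n IH] /=; first by split => //; rewrite measure0.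
  have [[mg gA gt] _] := gP _ IH; have [mC CA Ct] := IH.
  split; [exact: measurableU|by move=> x [/CA//|/gA[]]|].
  rewrite fprobU//; apply/seteqP; split => // x [Cx /gA[]] //.
have mC n : measurable (C n) by case: (gC n).
have CS n : C n `<=` C n.+1 by move=> x; left.
have Cmono m n : (m <= n)%N -> C m `<=` C n.
  elim: n => [|n IH]; first by rewrite leqn0 => /eqP ->.
  by rewrite leq_eqVlt => /predU1P[->//|/IH]; move/subset_trans; apply; exact: CS.
pose B := \bigcup_n C n.
have mB : measurable B by exact: bigcup_measurable.
have BA : B `<=` A by move=> x [n _]; case: (gC n) => _ + _; apply.
have Bt : q B <= t.
  have cvgB : Q (C n) @[n --> \oo] --> Q B.
    by apply: nondecreasing_cvg_mu => // m n mn; apply/subsetPset; exact: Cmono.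
  rewrite -lee_fin fine_prob// -(cvg_lim _ cvgB)//; apply: lime_le.
    by apply/cvg_ex; exists (Q B).
  by apply: nearW => n; rewrite -fine_prob// lee_fin; case: (gC n).
exists B; split => //; apply/eqP; rewrite eq_le Bt /= leNgt; apply/negP => Blt.
have AB0 : 0 < q (A `\` B) by rewrite fprobD//; lra.
have tB : 0 < t - q B by rewrite subr_gt0.
have [D [mD DAB D0 Dlt]] := nonatomic_small (measurableD mA mB) AB0 tB.
have Cn n : n%:R * (q D / 2) <= q (C n).
  elim: n => [|n IH]; first by rewrite mul0r fprob_ge0.
  have [[mg gA _] gmax] := gP _ (gC n).
  have cD : cand (C n) D.
    split => // [x /DAB[Ax Bx]|]; first by split => // Cx; apply: Bx; exists n.
    have : q (C n) <= q B by apply: fprob_le => // x Cx; exists n.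
    lra.
  have -> : C n.+1 = C n `|` g (C n) by [].
  rewrite fprobU//; last first.
    by apply/seteqP; split => // x [Cx /gA[]].
  have := gmax _ cD => h; by rewrite -natr1 mulrDl mul1r lerD// ler_pdivrMr// mulrC.
have := Cn (Num.truncn (1 / (q D / 2))).+1.
have : 1 / (q D / 2) < (Num.truncn (1 / (q D / 2))).+1%:R by exact: truncnS_gt.
have D2 : 0 < q D / 2 by lra.
rewrite ltr_pdivrMr// => /lt_le_trans h /h; apply/negP; rewrite -leNgt.
exact: fprob_le1.
Qed.

(** Halving the space repeatedly gives 2 ^ n cells of mass 2 ^ (-n) at level n, nested like the
    dyadic intervals. U x is the point whose binary digits record the cells containing x. *)
Lemma nonatomic_uniform : exists U : T -> R,
  [/\ measurable_fun setT U, (forall x, 0 <= U x <= 1) &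
      forall t, 0 <= t < 1 -> q [set x | U x <= t] = t].
Proof.
have [h hP] : {h : set T -> set T & forall A, measurable A ->
    [/\ measurable (h A), h A `<=` A & q (h A) = q A / 2]}.
  apply: (@choice _ _ (fun A B => measurable A ->
     [/\ measurable B, B `<=` A & q B = q A / 2])) => A.
  have [mA|] := pselect (measurable A); last by exists set0.
  have [|B BP] := @nonatomic_split A (q A / 2) mA; last by exists B.
  by have A0 := fprob_ge0 A; apply/andP; split; [exact: divr_ge0|rewrite ler_piMr// invf_le1// ler1n].
(* [K n x] is the index of the level-n cell of x: cell k splits into its chosen half, of index 2 k,
   and the remainder, of index 2 k + 1. *)
pose K : nat -> T -> nat := fix K n := match n with
  | 0%N => fun=> 0%N
  | n.+1 => fun x => (K n x).*2 + (x \notin h [set y | K n y = K n x])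
  end%N.
pose E n k := [set x | K n x = k].
have Eeven n k : measurable (E n k) -> E n.+1 k.*2 = h (E n k).
  move=> /hP[_ hE _]; apply/seteqP; split => x.
    rewrite /E /= => e.
    have /negP/negP : ~~ (x \notin h [set y | K n y = K n x]).
      by move/(congr1 odd) : e; rewrite oddD !odd_double; case: (x \notin _).
    rewrite negbK => xh; move: e; rewrite xh /= addn0 => /double_inj e.
    by move: xh; rewrite e inE.
  move=> hx; have e : K n x = k by apply: hE.
  rewrite /E /= e (_ : x \in _); first by rewrite addn0.
  by rewrite inE.
have Eodd n k : measurable (E n k) -> E n.+1 k.*2.+1 = E n k `\` h (E n k).
  move=> /hP[_ hE _]; apply/seteqP; split => x.
    rewrite /E /= => e.
    have xh : x \notin h [set y | K n y = K n x].
      by move/(congr1 odd) : e; rewrite oddD /= !odd_double; case: (x \notin _).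
    move: e; rewrite xh /= addn1 => -[/double_inj e].
    by split => //; move: xh; rewrite e notin_setE.
  move=> [e nhx]; rewrite /E /= in e *; rewrite e (_ : x \notin _); first by rewrite addn1.
  by rewrite notin_setE.
have mE n k : measurable (E n k) /\ ((k < 2 ^ n)%N -> q (E n k) = (2 ^ n)%:R^-1).
  elim: n k => [|n IH] k.
    case: k => [|k].
      have -> : E 0%N 0%N = setT by apply/seteqP; split.
      by split => // _; rewrite fprobT expn0 invr1.
    have -> : E 0%N k.+1 = set0 by apply/seteqP; split.
    by split => //; rewrite expn0 ltnS ltn0.
  rewrite -(odd_double_half k).
  have [mEk qEk] := IH k./2; have [mh hE qh] := hP _ mEk.
  have kn : (odd k + k./2.*2 < 2 ^ n.+1 -> k./2 < 2 ^ n)%N.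
    rewrite expnS mul2n -[(k./2 < _)%N]ltn_double.
    exact/leq_ltn_trans/leq_addl.
  have half : (2 ^ n.+1)%:R^-1 = (2 ^ n)%:R^-1 / 2 :> R.
    by rewrite expnS natrM invfM mulrC.
  case: (odd k) kn => kn; rewrite ?add0n ?add1n /= in kn *.
    rewrite Eodd//; split; first exact: measurableD.
    by move/kn => kn'; rewrite fprobD// qh qEk// half; lra.
  rewrite Eeven//; split=> // /kn kn'; by rewrite qh qEk// half.
(* [a n x] and [b n x] are the ends of the dyadic interval of the cell of x. These intervals
   decrease with n, and U x lies in all of them. *)
pose a n x := (K n x)%:R / (2 ^ n)%:R : R.
pose b n x := (K n x).+1%:R / (2 ^ n)%:R : R.
have p2 n : 0 < (2 ^ n)%:R :> R by rewrite ltr0n expn_gt0.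
have aS n x : a n x <= a n.+1 x.
  rewrite /a expnS natrM invfM mulrA ler_pM2r ?invr_gt0//.
  by rewrite ler_pdivlMr// -natrM ler_nat muln2 leq_addr.
have bS n x : b n.+1 x <= b n x.
  rewrite /b expnS natrM invfM mulrA ler_pM2r ?invr_gt0//.
  rewrite ler_pdivrMr// -natrM ler_nat muln2 doubleS ltnS.
  by rewrite -[X in (_ <= X)%N]addn1 leq_add2l leq_b1.
have amono x : {homo a^~ x : m n / (m <= n)%N >-> m <= n}.
  by apply: homo_leq => //; exact: le_trans.
have bmono x : {homo b^~ x : m n / (m <= n)%N >-> n <= m}.
  by apply: (homo_leq (r := fun u v => v <= u)) => // u v w /[swap]; exact: le_trans.
have ab m n x : a m x <= b n x.
  apply: (@le_trans _ _ (a (maxn m n) x)); first by rewrite amono// leq_maxl.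
  apply: (@le_trans _ _ (b (maxn m n) x)); last by rewrite bmono// leq_maxr.
  by rewrite /a /b ler_pM2r ?invr_gt0// ler_nat.
pose U x := sup (range (a^~ x)).
have hs x : has_sup (range (a^~ x)).
  split; first by exists (a 0%N x), 0%N.
  by exists (b 0%N x) => _ [n _ <-].
have aU n x : a n x <= U x by apply: sup_upper_bound => //; exists n.
have Ub n x : U x <= b n x.
  by apply: ge_sup => [|_ [m _ <-]]; [exists (a 0%N x), 0%N|].
have mU : measurable_fun setT U.
  apply: (@measurable_fun_cvg _ _ _ _ a) => [n|x _]; last first.
    by apply: nondecreasing_cvgn => //; case: (hs x).
  rewrite /a; apply: measurable_funM => //.
  rewrite (_ : (fun x => _) = (fun k : nat => k%:R) \o K n)//.
  apply: measurableT_comp => //.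
  move=> _ Y _; rewrite setTI [X in measurable X](_ : _ = \bigcup_(k in Y) E n k).
    by apply: bigcup_measurable => k _; case: (mE n k).
  apply/seteqP; split => [x Yx|x [k Yk]]; first by exists (K n x).
  by rewrite /E /= => ->.
exists U; split => // [x|t /andP[t0 t1]].
  by apply/andP; split; [apply: le_trans (aU 0%N x); rewrite /a mul0r|
    apply: le_trans (Ub 0%N x) _; rewrite /b divr1].
have lt_set n k : (k <= 2 ^ n)%N -> measurable [set x | (K n x < k)%N] /\
    q [set x | (K n x < k)%N] = k%:R / (2 ^ n)%:R.
  elim: k => [_|k IH kn].
    have -> : [set x | (K n x < 0)%N] = set0 by apply/seteqP; split.
    by rewrite mul0r fprob0.
  have [mk qk] := IH (ltnW kn); have [mEk qEk] := mE n k.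
  have -> : [set x | (K n x < k.+1)%N] = [set x | (K n x < k)%N] `|` E n k.
    apply/seteqP; split => x /=; rewrite /E /=.
      by rewrite ltnS [(K n x <= k)%N]leq_eqVlt => /predU1P[->|]; [right|left].
    by move=> [/leqW//|->]; exact: ltnSn.
  split; first exact: measurableU.
  rewrite fprobU// ?qk ?qEk// -?natr1; first lra.
  by apply/seteqP; split => // x [/= + e]; rewrite /E /= in e; rewrite e ltnn.
have mUt : measurable [set x | U x <= t].
  by rewrite -[X in measurable X]setTI; exact: measurable_fun_le.
(* For k = floor (t 2 ^ n), the event U <= t lies between the union of the first k cells and that of
   the first k + 1; both masses are within 2 ^ (-n) of t. As t < 1, cell k exists. *)
have bd n : `|q [set x | U x <= t] - t| <= (2 ^ n)%:R^-1.
  pose k := Num.truncn (t * (2 ^ n)%:R).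
  have /andP[k1 k2] := truncn_itv (mulr_ge0 t0 (ltW (p2 n))).
  have kn : (k < 2 ^ n)%N.
    rewrite -(ltr_nat R) (le_lt_trans k1)// -[ltRHS]mul1r ltr_pM2r//.
  have [m1 q1] := lt_set n k (ltnW kn); have [m2 q2] := lt_set n k.+1 kn.
  have l1 : q [set x | (K n x < k)%N] <= q [set x | U x <= t].
    apply: fprob_le => // x /= Kk; apply: le_trans (Ub n x) _.
    rewrite /b ler_pdivrMr//; apply: le_trans k1; by rewrite ler_nat.
  have l2 : q [set x | U x <= t] <= q [set x | (K n x < k.+1)%N].
    apply: fprob_le => // x /= Ut; have := le_trans (aU n x) Ut.
    rewrite /a ler_pdivrMr// => Kt; rewrite -(ltr_nat R); exact: le_lt_trans k2.
  rewrite q1 in l1; rewrite q2 -natr1 in l2.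
  rewrite -/k -natr1 in k2; rewrite -/k in k1.
  move: k1 k2; rewrite -ler_pdivrMr// -ltr_pdivlMr// => k1 k2.
  rewrite mulrDl mul1r in l2 k2.
  by rewrite ler_norml; lra.
apply/eqP; rewrite -subr_eq0 -normr_eq0 eq_le normr_ge0 andbT leNgt.
apply/negP => e0; set e := `|_| in e0 bd.
have := bd (Num.truncn e^-1).+1; rewrite leNgt => /negP; apply.
rewrite invf_plt ?posrE//; apply: lt_trans (truncnS_gt _) _.
by rewrite ltr_nat ltn_expl.
Qed.

End nonatomic_split.

(** * Laws on the line and distribution functions *)

Section real_laws.
Context (d : measure_display) (T : measurableType d) (R : realType)
  (Q : probability T R).
Local Notation q A := (fine (Q A)).

Lemma preimage_gt (X : T -> R) r :
  X @^-1` `]r, +oo[ = ~` [set x | X x <= r].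
Proof.
by apply/seteqP; split => x /=; rewrite in_itv /= andbT ltNge => /negP.
Qed.

Lemma measurable_fun_rays (X : T -> R) :
  (forall r, measurable [set x | X x <= r]) -> measurable_fun setT X.
Proof.
move=> mX; apply: (measurability (@RGenOInfty.G R)) => [|/= _ [_] [r] -> <-].
  exact: RGenOInfty.measurableE.
rewrite setTI preimage_gt; exact/measurableC/mX.
Qed.

Lemma measurable_rays (X : T -> R) r :
  measurable_fun setT X -> measurable [set x | X x <= r].
Proof. by move=> mX; rewrite -[X in measurable X]setTI; exact: measurable_fun_le. Qed.

Definition mfun_of (X : T -> R) (mX : measurable_fun setT X) : {mfun T >-> R} :=
  mfun_Sub (mem_set mX : X \in mfun).

(** The open right rays are stable under intersection, generate the Borel sets and exhaust the line,
    so finite measures agreeing on them are equal. *)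
Lemma same_law_cdf (X Y : T -> R) : measurable_fun setT X -> measurable_fun setT Y ->
  (forall r, q [set x | X x <= r] = q [set x | Y x <= r]) -> same_law Q X Y.
Proof.
move=> mX mY XY B mB.
pose X' := mfun_of mX; pose Y' := mfun_of mY.
apply: (@measure_unique _ R R (@RGenOInfty.G R) (fun k => `]- k%:R, +oo[%classic) _ _ _ _
   (distribution Q (X' : {RV Q >-> R})) (distribution Q (Y' : {RV Q >-> R}))) => //.
- exact: RGenOInfty.measurableE.
- move=> _ _ [a ->] [b ->]; exists (Num.max a b).
  apply/seteqP; split => x /=; rewrite !in_itv /= !andbT gt_max.
    by move=> [-> ->].
  by move=> /andP[].
- by move=> k; exists (- k%:R).
- rewrite -subTset => x _; exists (Num.truncn `|x|).+1 => //=.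
  rewrite in_itv /= andbT ltrNl.
  by rewrite (le_lt_trans _ (truncnS_gt _))// -normrN ler_norm.
- move=> _ [r ->]; change (Q (X @^-1` `]r, +oo[) = Q (Y @^-1` `]r, +oo[)).
  rewrite !preimage_gt !probability_setC//; try exact: measurable_rays.
  by rewrite -(fine_prob Q (measurable_rays r mX)) -(fine_prob Q (measurable_rays r mY)) XY.
- by move=> k; rewrite (le_lt_trans (probability_le1 _ _))// ltry.
Qed.

End real_laws.

(** * Cyclic shifts of a uniform variable *)

Section shifts.
Context (d : measure_display) (T : measurableType d) (R : realType)
  (Q : probability T R) (naQ : nonatomic Q).
Local Notation q A := (fine (Q A)).

Lemma fprob_eq_outside_null (A B G : set T) : measurable A -> measurable B ->
  measurable G -> q G = 0 -> (forall x, ~ G x -> A x <-> B x) -> q A = q B.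
Proof.
move=> mA mB mG G0 AB; apply/eqP; rewrite eq_le.
have H (C D : set T) : measurable C -> measurable D -> (forall x, ~ G x -> C x -> D x) -> q C <= q D.
  move=> mC mD CD; have CDG : C `<=` D `|` G.
    by move=> x Cx; have [|nGx] := pselect (G x); [right|left; exact: CD].
  apply: le_trans (fprob_le Q mC (measurableU _ _ mD mG) CDG) _.
  have h : (Q (D `|` G) <= Q D + Q G)%E by exact: measureU2.
  rewrite -(fine_prob Q (measurableU _ _ mD mG)) -(fine_prob Q mD) in h.
  by rewrite -(fine_prob Q mG) -EFinD G0 addr0 lee_fin in h.
by apply/andP; split; apply: H => // x nG /AB; apply.
Qed.

(** The grid of multiples of 1 / (N + 1) is removed so that cells can be treated as open intervals.
    A uniform variable has no atoms, hence meets the grid with probability 0 and may be redefined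
    there. *)
Lemma nonatomic_uniform_offgrid (N : nat) : exists V : T -> R,
  [/\ measurable_fun setT V, (forall x, 0 < V x < 1),
      (forall x k, V x * N.+1%:R != k%:R) &
      forall t, 0 <= t <= 1 -> q [set x | V x <= t] = t].
Proof.
have [U [mU U01 qU]] := nonatomic_uniform naQ.
have mr r : measurable [set x | U x <= r] by exact: measurable_rays.
have qU1 t : 0 <= t <= 1 -> q [set x | U x <= t] = t.
  move=> /andP[t0]; rewrite le_eqVlt => /predU1P[->|t1]; last by apply: qU; rewrite t0.
  rewrite (_ : [set x | _] = setT) ?fprobT//.
  by apply/seteqP; split => // x _; case/andP : (U01 x).
have matom r : measurable [set x | U x = r].
  rewrite (_ : [set x | U x = r] = U @^-1` [set r])//.
  by rewrite -[X in measurable X]setTI; exact: mU.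
have atom r : q [set x | U x = r] = 0.
  apply/eqP; rewrite eq_le fprob_ge0 andbT leNgt; apply/negP => c0.
  have : [set x | U x = r] !=set0.
    apply/set0P; apply: contraTneq c0 => ->; by rewrite fprob0 ltxx.
  move=> [y /= yr]; have /andP[r0 r1] : 0 <= r <= 1 by rewrite -yr.
  have [re|rn0] := eqVneq r 0.
    move: c0; rewrite ltNge => /negP; apply.
    rewrite -[leRHS](qU1 0) ?lexx ?ler01//; apply: fprob_le => // x /= ->.
    by rewrite re.
  (* An atom of mass c at r would lie in the event r - e < U <= r, of mass e <= c / 2; e <= r keeps
     r - e in [0, 1]. *)
  set c := q _ in c0; pose e := Num.min (c / 2) r.
  have e0 : 0 < e by rewrite lt_min divr_gt0//= lt_neqAle eq_sym rn0.
  have [ec er] : e <= c / 2 /\ e <= r by rewrite !ge_min !lexx orbT.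
  have : c <= q ([set x | U x <= r] `\` [set x | U x <= r - e]).
    apply: fprob_le => //; first exact: measurableD.
    by move=> x /= ->; split => //; apply/negP; rewrite -ltNge; lra.
  rewrite fprobD//; last by move=> x /= /le_trans; apply; lra.
  by rewrite !qU1//; try (apply/andP; split); lra.
pose G := \bigcup_k [set x | U x = k%:R / N.+1%:R].
have mG : measurable G by apply: bigcup_measurable.
have G0 : q G = 0.
  rewrite (_ : Q G = 0%E)//; apply: measure_negligible => //.
  apply: negligible_bigcup => k; apply/negligibleP => //.
  have h : Q [set x | U x = k%:R / N.+1%:R] = 0%E by rewrite -(fine_prob Q (matom _)) atom.
  exact: h.
have N0 : 0 < N.+1%:R :> R by [].
(* The replacement value is the midpoint of the first grid cell. The grid contains 0 and 1, so [V]
   stays in the open interval. *)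
pose V x := if x \in G then (2 * N.+1%:R)^-1 else U x.
have VU x : ~ G x -> V x = U x.
  by move=> nG; rewrite /V; case: ifPn => // /set_mem.
have mV : measurable_fun setT V.
  apply: measurable_fun_ifT => //; apply: (measurable_fun_bool true).
  rewrite setTI (_ : _ @^-1` _ = G)//.
  by apply/seteqP; split => x /= => [/set_mem|/mem_set].
exists V; split => //.
- move=> x; rewrite /V; case: ifPn => [_|/negP xG].
    rewrite invr_gt0 mulr_gt0//= invf_lt1 ?mulr_gt0//.
    have N1 : 1 <= N.+1%:R :> R by rewrite ler1n.
    by lra.
  have /andP[u0 u1] := U01 x; rewrite !lt_neqAle u0 u1 !andbT; apply/andP; split.
    by apply/eqP => e; apply: xG; rewrite inE; exists 0%N => //=; rewrite mul0r.
  by apply/eqP => e; apply: xG; rewrite inE; exists N.+1 => //=; rewrite divff.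
- move=> x k; rewrite /V; case: ifPn => [_|/negP xG]; last first.
    apply/eqP => e; apply: xG; rewrite inE; exists k => //=.
    by rewrite -e mulfK.
  rewrite invfM mulfVK//; apply/eqP => e.
  have : 0 < (k%:R : R) by rewrite -e invr_gt0.
  have : (k%:R : R) < 1 by rewrite -e invf_lt1// ltr1n.
  by rewrite -[1]/(1%:R) ltr_nat ltnS leqn0 => /eqP ->; rewrite ltxx.
- move=> t t01; rewrite -[RHS](qU1 _ t01).
  apply: (@fprob_eq_outside_null _ _ G) => //; first exact: measurable_rays.
  by move=> x /VU /= ->.
Qed.

(** Term l is the length of [0, z] inside [l, l + 1]; the lengths add up to that of [0, z] inside
    [0, n]. *)
Lemma clamp_sum (z : R) n : 0 <= z ->
  \sum_(l < n) Num.max 0 (Num.min 1 (z - l%:R)) = Num.min z n%:R.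
Proof.
move=> z0; elim: n => [|n IH]; first by rewrite big_ord0 min_r.
rewrite big_ord_recr /= IH -natr1.
rewrite /Num.min /Num.max; do !case: ifPn; rewrite -?leNgt; lra.
Qed.

(** Write V = (J + W) / (N + 1) with J the integer and W the fractional part of (N + 1) V. Shift i
    replaces J by J + i modulo N + 1. The shifts stay uniform because J and W are independent and
    uniform, and at each point they run through all (l + w) / (N + 1) with the same w = W x. *)
Lemma nonatomic_shifts (N : nat) : exists V : 'I_N.+1 -> T -> R,
  [/\ (forall i x, 0 < V i x < 1),
      (forall i t, 0 <= t <= 1 -> measurable [set x | V i x <= t] /\
                                  q [set x | V i x <= t] = t) &
      forall x, exists w : R, 0 < w < 1 /\ forall g : R -> R,
        \sum_i g (V i x) = \sum_(l < N.+1) g ((l%:R + w) / N.+1%:R)].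
Proof.
have [V [mV V01 Vgrid qV]] := nonatomic_uniform_offgrid N.
have N0 : 0 < N.+1%:R :> R by [].
pose J x : 'I_N.+1 := inord (Num.truncn (V x * N.+1%:R)).
pose W x := V x * N.+1%:R - (J x)%:R.
have VN x : 0 < V x * N.+1%:R < N.+1%:R.
  have /andP[v0 v1] := V01 x; rewrite mulr_gt0//=.
  by rewrite -[ltRHS]mul1r ltr_pM2r.
have JE x : (J x)%:R < V x * N.+1%:R < (J x)%:R + 1.
  have /andP[v0 v1] := VN x.
  have /andP[t0 t1] := truncn_itv (ltW v0).
  have e : J x = Num.truncn (V x * N.+1%:R) :> nat.
    by rewrite inordK// -(ltr_nat R) (le_lt_trans t0).
  rewrite e natr1 t1 andbT lt_neqAle t0 andbT eq_sym.
  exact: Vgrid.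
have W01 x : 0 < W x < 1 by have := JE x; rewrite /W; lra.
have JW j s : 0 <= s <= 1 -> measurable [set x | J x = j /\ W x <= s] /\
    q [set x | J x = j /\ W x <= s] = s / N.+1%:R.
  move=> /andP[s0 s1].
  have jN : j%:R + 1 <= N.+1%:R :> R by rewrite natr1 ler_nat.
  have j0 : 0 <= j%:R :> R by [].
  have -> : [set x | J x = j /\ W x <= s] =
     [set x | V x <= (j%:R + s) / N.+1%:R] `\` [set x | V x <= j%:R / N.+1%:R].
    apply/seteqP; split => x /=.
      move=> [<-]; rewrite /W => Ws; have := JE x; rewrite !ler_pdivlMr// => h.
      by split; [lra|apply/negP; rewrite -ltNge; lra].
    rewrite !ler_pdivlMr// => -[h1 /negP]; rewrite -ltNge => h2.
    have e : J x = j.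
      apply/val_inj/eqP; rewrite /= eqn_leq -ltnS -[(j <= _)%N]ltnS.
      rewrite -!(ltr_nat R) -!natr1; have := JE x => h.
      (* For s = 1 the right end is a grid point, which [V] avoids. *)
      have h3 : V x * N.+1%:R < j%:R + 1.
        rewrite lt_neqAle; apply/andP; split; last lra.
        by rewrite natr1; exact: Vgrid.
      by apply/andP; split; lra.
    by split => //; rewrite /W e; lra.
  split; first by apply: measurableD; exact: measurable_rays.
  rewrite fprobD; last 3 first.
  - exact: measurable_rays.
  - exact: measurable_rays.
  - by move=> x /= /le_trans; apply; rewrite ler_pM2r ?invr_gt0//; lra.
  rewrite (qV ((j%:R + s) / N.+1%:R)); last first.
    by rewrite divr_ge0 ?addr_ge0//= ler_pdivrMr//; lra.
  rewrite (qV (j%:R / N.+1%:R)); last by rewrite divr_ge0//= ler_pdivrMr//; lra.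
  by rewrite mulrDl addrAC subrr add0r.
exists (fun i x => ((J x + i)%R%:R + W x) / N.+1%:R); split.
- move=> i x; have /andP[w0 w1] := W01 x.
  have h0 : 0 <= (J x + i)%R%:R :> R by [].
  have h1 : (J x + i)%R%:R + 1 <= N.+1%:R :> R by rewrite natr1 ler_nat.
  apply/andP; split; first by rewrite divr_gt0//; lra.
  by rewrite ltr_pdivrMr//; lra.
- move=> i t /andP[t0 t1].
  (* On J = j the event that shift i is at most t reads W <= t (N + 1) - (j + i); as 0 < W < 1, the
     threshold may be clamped to [0, 1]. *)
  pose c (j : 'I_N.+1) := Num.max 0 (Num.min 1 (t * N.+1%:R - (j + i)%R%:R)).
  have c01 j : 0 <= c j <= 1.
    rewrite /c le_max lexx /= ge_max ler01 /= ge_min lexx //.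
  pose S (j : 'I_N.+1) := [set x | J x = j /\ W x <= c j].
  have mS j : measurable (S j) by case: (JW j (c j) (c01 j)).
  have -> : [set x | ((J x + i)%R%:R + W x) / N.+1%:R <= t] = \bigcup_(j in [set: 'I_N.+1]) S j.
    apply/seteqP; split => x /=.
      rewrite ler_pdivrMr// => h; exists (J x) => //=.
      split => //; have := W01 x => w.
      by rewrite /c le_max le_min; apply/orP; right; apply/andP; split; lra.
    move=> [j _]; rewrite /S /= => -[<-]; rewrite /c le_max le_min.
    have := W01 x => w /orP[|/andP[_]]; first lra.
    by rewrite ler_pdivrMr//; lra.
  have fI : finite_set [set: 'I_N.+1] by exact: finite_finset.
  split; first exact: fin_bigcup_measurable.
  rewrite measure_fin_bigcup//; last by move=> j k _ _ [x [[<- _] [<- _]]].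
  rewrite (_ : [set: 'I_N.+1] = [set` index_enum 'I_N.+1]); last first.
    by apply/seteqP; split => // j _ /=; rewrite mem_index_enum.
  rewrite -fsbig_seq ?index_enum_uniq//.
  rewrite (eq_bigr (fun j => (c j / N.+1%:R)%:E)); last first.
    move=> j _; have [_ <-] := JW j (c j) (c01 j).
    by have := fine_prob Q (mS j) => ->.
  rewrite sumEFin /= -mulr_suml.
  rewrite (reindex_inj (addIr (- i))) /=.
  rewrite (eq_bigr (fun j : 'I_N.+1 => Num.max 0 (Num.min 1 (t * N.+1%:R - j%:R)))); last first.
    by move=> j _; rewrite /c subrK.
  rewrite clamp_sum ?mulr_ge0// min_l ?mulfK//.
  by rewrite -[leRHS]mul1r ler_pM2r.
- move=> x; exists (W x); split => // g.
  rewrite [RHS](reindex_inj (addrI (J x))) /=.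
  by apply: eq_bigr.
Qed.

End shifts.

(** * Rearrangements *)

Section quantile.
Context (d : measure_display) (T : measurableType d) (R : realType)
  (Q : probability T R).
Local Notation q A := (fine (Q A)).

(** The quantile function is g u = inf {r | u <= F r}. The limits of the distribution function F at
    -oo and +oo make this set bounded below and nonempty for 0 < u < 1, and right-continuity puts
    the infimum in it, which gives the Galois relation. *)
Lemma quantile_exists (X : T -> R) : measurable_fun setT X ->
  exists g : R -> R, forall u r, 0 < u < 1 ->
    (g u <= r) = (u <= q [set x | X x <= r]).
Proof.
move=> mX; pose X' : {RV Q >-> R} := mfun_of mX.
pose F r := q [set x | X x <= r].
have cdfE r : cdf X' r = (F r)%:E.
  rewrite /F fine_prob; last exact: measurable_rays.
  by [].
have Fmono r s : r <= s -> F r <= F s.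
  move=> rs; apply: fprob_le; [exact: measurable_rays..|].
  by move=> x /= /le_trans; apply.
pose S u := [set r | u <= F r].
exists (fun u => inf (S u)) => u r /andP[u0 u1].
have [r1 Sr1] : S u !=set0.
  have u1' : (u%:E < 1 :> \bar R)%E by rewrite lte_fin.
  have H : \forall s \near +oo, (u%:E < cdf X' s)%E by exact: (cvg_cdfy1 X' (open_ereal_gt' u1')).
  have [s] := filter_ex H.
  by rewrite cdfE lte_fin => /ltW; exists s.
have [r0 Fr0] : exists r0, F r0 < u.
  have u0' : (0 < u%:E :> \bar R)%E by rewrite lte_fin.
  have H : \forall s \near -oo, (cdf X' s < u%:E)%E by exact: (cvg_cdfNy0 X' (open_ereal_lt' u0')).
  have [s] := filter_ex H.
  by rewrite cdfE lte_fin; exists s.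
have lbS : has_lbound (S u).
  exists r0 => s /= us; rewrite leNgt; apply/negP => /ltW/Fmono.
  by rewrite leNgt (lt_le_trans Fr0).
have hinf : has_inf (S u) by split => //; exists r1.
have Sinf : S u (inf (S u)).
  rewrite /S /= leNgt; apply/negP => Fu.
  have Fu' : (cdf X' (inf (S u)) < u%:E)%E by rewrite cdfE lte_fin.
  have H : \forall s \near (inf (S u))^'+, (cdf X' s < u%:E)%E.
    exact: (cdf_right_continuous (open_ereal_lt' Fu')).
  have [s [sinf]] := filter_ex (filterI (nbhs_right_gt (inf (S u))) H).
  rewrite cdfE lte_fin; apply/negP; rewrite -leNgt.
  have s0 : 0 < s - inf (S u) by rewrite subr_gt0.
  have [t /= St] := inf_adherent s0 hinf; rewrite subrKC => /ltW/Fmono.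
  exact: le_trans.
apply/idP/idP => [h|ur]; first by apply: le_trans (Fmono _ _ h).
exact: ge_inf.
Qed.

End quantile.

Section same_law_integrals.
Context (d : measure_display) (T : measurableType d) (R : realType)
  (Q : probability T R).

Lemma same_law_ge0_integral (X Y : T -> R) (f : R -> \bar R) (B : set R) :
  measurable_fun setT X -> measurable_fun setT Y -> same_law Q X Y ->
  measurable B -> measurable_fun B f -> (forall r, 0 <= f r)%E ->
  (\int[Q]_(x in X @^-1` B) f (X x) = \int[Q]_(x in Y @^-1` B) f (Y x))%E.
Proof.
move=> mX mY XY mB mf f0.
have := @ge0_integral_pushforward _ _ _ _ _ _ mX Q B f mB mf (fun r _ => f0 r).
have := @ge0_integral_pushforward _ _ _ _ _ _ mY Q B f mB mf (fun r _ => f0 r).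
rewrite /= => <- <-.
apply: eq_measure_integral => A mA _; exact: XY.
Qed.

Lemma same_law_integral (X Y : T -> R) (f : R -> \bar R) (B : set R) :
  measurable_fun setT X -> measurable_fun setT Y -> same_law Q X Y ->
  measurable B -> measurable_fun B f ->
  (\int[Q]_(x in X @^-1` B) f (X x) = \int[Q]_(x in Y @^-1` B) f (Y x))%E.
Proof.
move=> mX mY XY mB mf.
have E (Z : T -> R) : (\int[Q]_(x in Z @^-1` B) f (Z x) =
    \int[Q]_(x in Z @^-1` B) f^\+%E (Z x) - \int[Q]_(x in Z @^-1` B) f^\-%E (Z x))%E.
  rewrite -[LHS]/(\int[Q]_(x in Z @^-1` B) (f \o Z) x)%E integralE.
  congr (_ - _)%E; apply: eq_integral => x _.
    by have -> : (f \o Z)^\+%E = f^\+%E \o Z by exact: funepos_comp.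
  by have -> : (f \o Z)^\-%E = f^\-%E \o Z by exact: funeneg_comp.
rewrite !E; congr (_ - _)%E.
  exact: (@same_law_ge0_integral X Y f^\+%E B mX mY XY mB (measurable_funepos mf)).
exact: (@same_law_ge0_integral X Y f^\-%E B mX mY XY mB (measurable_funeneg mf)).
Qed.

Lemma same_law_sym (X Y : T -> R) : same_law Q X Y -> same_law Q Y X.
Proof. by move=> XY B /XY ->. Qed.

End same_law_integrals.

Section rearrangement.
Context (d : measure_display) (T : measurableType d) (R : realType)
  (Q : probability T R).
Local Notation q A := (fine (Q A)).

Definition clamp (K r : R) : R := Num.max (- K) (Num.min r K).

Lemma clamp_le (K : R) : {homo clamp K : r s / r <= s}.
Proof.
move=> r s rs; rewrite /clamp /Num.max /Num.min.
by do !case: ifPn; rewrite -?leNgt; lra.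
Qed.

Lemma clamp_bound (K r : R) : 0 <= K -> - K <= clamp K r <= K.
Proof. by rewrite /clamp /Num.max /Num.min => K0; do !case: ifPn; rewrite -?leNgt; lra. Qed.

Lemma clamp_id (K r : R) : `|r| <= K -> clamp K r = r.
Proof.
rewrite ler_norml => /andP[h1 h2].
by rewrite /clamp /Num.max /Num.min; do !case: ifPn; rewrite -?leNgt; lra.
Qed.

Lemma clamp_tail_le (K r : R) : 0 <= K -> `|r - clamp K r| <= `|r|.
Proof.
move=> K0; have := ler_norm r; have := ler_norm (- r); rewrite normrN => h1 h2.
rewrite ler_norml /clamp /Num.max /Num.min; do !case: ifPn; rewrite -?leNgt => *.
all: by apply/andP; split; lra.
Qed.

Lemma measurable_clamp (K : R) : measurable_fun setT (clamp K).
Proof. by apply: nondecreasing_measurable => //; exact: clamp_le. Qed.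

(* The values of a monotone function bounded by K at the points (l + w) / N
   interlace for two values of w, so that the two sums differ by at most the
   oscillation 2 K. *)
Lemma interlacing_sums (a b : nat -> R) (K : R) n :
  (forall l, (l < n)%N -> a l <= b l.+1) -> (forall l, (l <= n)%N -> - K <= b l) ->
  (forall l, (l <= n)%N -> a l <= K) ->
  \sum_(l < n.+1) a l <= \sum_(l < n.+1) b l + 2 * K.
Proof.
move=> ab bK aK; rewrite big_ord_recr [X in _ <= X + _]big_ord_recl /=.
have : \sum_(l < n) a l <= \sum_(i < n) b (bump 0 i).
  by apply: ler_sum => l _; apply: ab.
by have := bK 0%N isT; have := aK n (leqnn n); lra.
Qed.

(** The copies are the quantile function at the shifts of a uniform variable. At two points x and y,
    the shifts form interlacing grids with offsets w and w', whence the oscillation 2 K of the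
    clamped sum. It does not grow with N, so the mean becomes uniformly close to a constant. *)
Lemma nonatomic_rearrangements (X : T -> R) (N : nat) :
  nonatomic Q -> measurable_fun setT X ->
  exists Xi : 'I_N.+1 -> T -> R,
    [/\ (forall i, measurable_fun setT (Xi i)), (forall i, same_law Q X (Xi i)) &
        forall K, 0 <= K -> forall x y,
          \sum_i clamp K (Xi i x) <= \sum_i clamp K (Xi i y) + 2 * K].
Proof.
move=> naQ mX; have [g gP] := quantile_exists Q mX.
have [V [V01 qV VS]] := nonatomic_shifts naQ N.
have F01 r : 0 <= q [set x | X x <= r] <= 1.
  rewrite fprob_ge0/= fprob_le1//; exact: measurable_rays.
have XiE i r : [set x | g (V i x) <= r] = [set x | V i x <= q [set y | X y <= r]].
  by apply/seteqP; split => x /=; rewrite gP.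
have mXi i : measurable_fun setT (fun x => g (V i x)).
  by apply: measurable_fun_rays => r; rewrite XiE; case: (qV i _ (F01 r)).
exists (fun i x => g (V i x)); split => //.
- move=> i; apply: same_law_cdf => // r; rewrite XiE.
  by have [_ ->] := qV i _ (F01 r).
- move=> K K0 x y.
  have [w [/andP[w0 w1] /(_ (clamp K \o g)) VSx]] := VS x.
  have [w' [/andP[w'0 w'1] /(_ (clamp K \o g)) VSy]] := VS y.
  rewrite [leLHS]VSx [X in _ <= X + _]VSy.
  have gmono u v : 0 < u < 1 -> 0 < v < 1 -> u <= v -> g u <= g v.
    by move=> u01 v01 uv; rewrite gP// (le_trans uv)// -gP.
  have N0 : 0 < N.+1%:R :> R by [].
  have in01 (l : nat) (s : R) : (l <= N)%N -> 0 < s < 1 -> 0 < (l%:R + s) / N.+1%:R < 1.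
    move=> lN s01; have l0 : 0 <= l%:R :> R by [].
    have lN' : l%:R + 1 <= N.+1%:R :> R by rewrite natr1 ler_nat.
    by apply/andP; split; [rewrite divr_gt0//|rewrite ltr_pdivrMr//]; lra.
  apply: (@interlacing_sums (fun l => clamp K (g ((l%:R + w) / N.+1%:R)))
     (fun l => clamp K (g ((l%:R + w') / N.+1%:R)))).
  + move=> l lN; apply: clamp_le; apply: gmono; [apply: in01; [exact: ltnW|lra]|apply: in01; [by []|lra]|].
    by rewrite ler_pM2r ?invr_gt0// -natr1; lra.
  + by move=> l _; have := clamp_bound (g ((l%:R + w') / N.+1%:R)) K0; lra.
  + by move=> l _; have := clamp_bound (g ((l%:R + w) / N.+1%:R)) K0; lra.
Qed.

End rearrangement.

Section integral_facts.
Context (d : measure_display) (T : measurableType d) (R : realType)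
  (Q : probability T R).

Lemma Rintegral_sum n (f : 'I_n -> T -> R) :
  (forall i, Q.-integrable setT (EFin \o f i)) ->
  Q.-integrable setT (EFin \o (fun x => \sum_i f i x)) /\
  \int[Q]_x (\sum_i f i x) = \sum_i \int[Q]_x f i x.
Proof.
elim: n f => [|n IH] f fi.
  have -> : (fun x => \sum_(i < 0) f i x) = cst 0 by apply/funext => x; rewrite big_ord0.
  split; last by rewrite big_ord0 Rintegral_cst// mul0r.
  exact: integrable0.
have [iS eS] := IH (fun i => f (widen_ord (leqnSn n) i)) (fun i => fi _).
have -> : (fun x => \sum_(i < n.+1) f i x) =
  (fun x => \sum_(i < n) f (widen_ord (leqnSn n) i) x + f ord_max x).
  by apply/funext => x; rewrite big_ord_recr.
split.
  rewrite (_ : EFin \o _ = (EFin \o (fun x => \sum_(i < n) f (widen_ord (leqnSn n) i) x)%R)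
     \+ (EFin \o f ord_max))%E; last by apply/funext => x /=; rewrite EFinD.
  exact: integrableD.
by rewrite RintegralD// eS big_ord_recr.
Qed.

Lemma integrable_bounded (f : T -> R) (K : R) : measurable_fun setT f ->
  (forall x, `|f x| <= K) -> Q.-integrable setT (EFin \o f).
Proof.
move=> mf fK; apply: (@le_integrable _ _ _ _ _ _ _ (EFin \o cst K)) => //.
- exact/measurable_EFinP.
- by move=> x _ /=; rewrite lee_fin (le_trans (fK x))// ler_norm.
- exact: finite_measure_integrable_cst.
Qed.

(** Dominated convergence in the form needed for tails, which vanish at each point from some index
    on. *)
Lemma integral_eventually0 (h : nat -> T -> \bar R) (g : T -> \bar R) (e : R) :
  (forall n, measurable_fun setT (h n)) -> Q.-integrable setT g ->
  (forall n x, `|h n x| <= g x)%E ->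
  (forall x, exists m, forall n, (m <= n)%N -> h n x = 0%E) -> 0 < e ->
  \forall n \near \oo, (\int[Q]_x h n x < e%:E)%E.
Proof.
move=> mh ig hg h0 e0.
have H1 : {ae Q, forall x, setT x -> h ^~ x @ \oo --> cst 0%E x}.
  apply: aeW => x _; have [m hm] := h0 x; apply: cvg_near_cst.
  by exists m => // n mn /=; exact: hm.
have H2 : {ae Q, forall x n, setT x -> (`|h n x| <= g x)%E}.
  by apply: aeW => x n _; exact: hg.
have [_ _ H] := dominated_convergence measurableT mh (measurable_cst 0%E) H1 ig H2.
rewrite integral0 in H.
have e0' : (0 < e%:E :> \bar R)%E by rewrite lte_fin.
by exact: (H _ (open_ereal_lt' e0')).
Qed.

End integral_facts.

(** * Means of rearrangements approach the expectation in modular *)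

Section rearrangement_modular.
Context (d : measure_display) (T : measurableType d) (R : realType)
  (Q : probability T R) (Phi : R -> R) (hPhi : orlicz_function Phi).

Lemma orlicz_jensen_sum n (a : 'I_n.+1 -> R) : (forall i, 0 <= a i) ->
  Phi ((\sum_i a i) / n.+1%:R) <= (\sum_i Phi (a i)) / n.+1%:R.
Proof.
elim: n a => [|n IH] a a0; first by rewrite !big_ord1 !divr1.
rewrite !(big_ord_recr n.+1) /=.
set s := \sum_(i < n.+1) _; set t := \sum_(i < n.+1) _.
have s0 : 0 <= s by apply: sumr_ge0.
have N0 : 0 < n.+1%:R :> R by []. have N20 : 0 < n.+2%:R :> R by [].
have N2 : n.+2%:R = n.+1%:R + 1 :> R by rewrite natr1.
pose c : R := n.+1%:R / n.+2%:R.
have c01 : 0 <= c <= 1.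
  by rewrite /c divr_ge0//= ler_pdivrMr// mul1r N2; lra.
have mix (p u v : R) : 0 < p -> p / (p + 1) * (u / p) + (1 - p / (p + 1)) * v = (u + v) / (p + 1).
  move=> p0; have p1 : p + 1 != 0 by apply: lt0r_neq0; lra.
  by field; rewrite p1 gt_eqF.
have := orlicz_convex hPhi (divr_ge0 s0 (ltW N0)) (a0 ord_max) c01.
have -> : c * (s / n.+1%:R) + (1 - c) * a ord_max = (s + a ord_max) / n.+2%:R.
  by rewrite /c N2 mix.
move=> /le_trans; apply.
have -> : (t + Phi (a ord_max)) / n.+2%:R = c * (t / n.+1%:R) + (1 - c) * Phi (a ord_max).
  by rewrite /c N2 mix.
rewrite lerD2r ler_wpM2l//; first by case/andP : c01.
exact: IH.
Qed.

(** Continuity at 0 comes from convexity: Phi s <= s * Phi 1 for s <= 1. *)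
Lemma orlicz_small (e : R) : 0 < e -> exists2 s, 0 < s & Phi s <= e.
Proof.
move=> e0; have P1 := orlicz_gt0 hPhi (@ltr01 R).
exists (Num.min 1 (e / Phi 1)); first by rewrite lt_min ltr01 divr_gt0.
set s := Num.min _ _; have s1 : s <= 1 by rewrite ge_min lexx.
have s0 : 0 <= s by rewrite le_min ler01 divr_ge0// ltW.
have := @orlicz_scale _ _ hPhi s 1; rewrite s0 s1 mulr1 => /(_ isT ler01)/le_trans.
by apply; rewrite -ler_pdivlMr// ge_min lexx orbT.
Qed.

(** The mean of the copies is the mean of their truncations plus the mean of their tails. The former
    is within eta = s l of the expectation everywhere; the latter is small in modular by Jensen's
    inequality and equality of laws. Midpoint convexity combines the two at the cost of the scale 2
    l. *)
Lemma rearrangement_modular (X : T -> R) (l e : R) :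
  nonatomic Q -> measurable_fun setT X -> Q.-integrable setT (EFin \o X) ->
  0 < l -> (\int[Q]_x (Phi (`|X x| / l))%:E < +oo)%E -> 0 < e ->
  exists (N : nat) (Xi : 'I_N.+1 -> T -> R),
    [/\ (forall i, measurable_fun setT (Xi i)), (forall i, same_law Q X (Xi i)) &
     (\int[Q]_x (Phi (`|(\sum_i Xi i x) / N.+1%:R - \int[Q]_y X y| / (2 * l)))%:E
       <= e%:E)%E].
Proof.
move=> naQ mX iX l0 Xl e0; have l0' := ltW l0.
have [s s0 se] := orlicz_small e0; pose eta := s * l.
have eta0 : 0 < eta by exact: mulr_gt0.
pose tail K r : R := r - clamp K r.
have mtail K : measurable_fun setT (tail K).
  by apply: measurable_funB => //; exact: measurable_clamp.
have mtX K : measurable_fun setT (fun x => tail K (X x)) by exact: measurableT_comp.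
have tail0 x : exists m, forall n, (m <= n)%N -> tail n%:R (X x) = 0.
  exists (Num.truncn `|X x|).+1 => n mn; rewrite /tail clamp_id ?subrr//.
  by rewrite (le_trans (ltW (truncnS_gt _)))// ler_nat.
have iPX : Q.-integrable setT (fun x => (Phi (`|X x| / l))%:E).
  apply/integrableP; split; first exact: measurable_orliczE.
  by under eq_integral do rewrite gee0_abs ?lee_fin ?orlicz_norm_ge0//.
have near1 : \forall n \near \oo, (\int[Q]_x (Phi (`|tail n%:R (X x)| / l))%:E < e%:E)%E.
  apply: integral_eventually0 iPX _ _ e0 => [n|n x|x].
  - exact: measurable_orliczE.
  - rewrite gee0_abs ?lee_fin ?orlicz_norm_ge0//.
    apply: orlicz_le => //; first by rewrite divr_ge0.
    by rewrite ler_pM2r ?invr_gt0// clamp_tail_le.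
  - have [m hm] := tail0 x; exists m => n mn.
    by rewrite hm// normr0 mul0r orlicz_0.
have near2 : \forall n \near \oo, (\int[Q]_x (`|tail n%:R (X x)|)%:E < (eta / 2)%:E)%E.
  have iX' := integrable_norm iX.
  apply: integral_eventually0 iX' _ _ _ => [n|n x|x|].
  - by apply/measurable_EFinP; exact: measurableT_comp.
  - by rewrite gee0_abs ?lee_fin//= clamp_tail_le.
  - by have [m hm] := tail0 x; exists m => n mn; rewrite hm// normr0.
  - by rewrite divr_gt0.
have [n [int1 int2]] := filter_ex (filterI near1 near2).
pose K : R := n%:R; have K0 : 0 <= K by [].
(* This makes the oscillation 2 K / (N + 1) of the truncated mean at most eta / 2; the first moment
   of the tail takes the other half of eta. *)
pose N := Num.truncn (4 * K / eta).
have NK : 2 * K / N.+1%:R <= eta / 2.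
  have : 4 * K / eta < N.+1%:R by exact: truncnS_gt.
  by rewrite ltr_pdivrMr// ler_pdivrMr//; lra.
have [Xi [mXi XXi osc]] := nonatomic_rearrangements N naQ mX.
exists N, Xi; split => //.
have N0 : 0 < N.+1%:R :> R by [].
set m := \int[Q]_y X y.
pose mc := \int[Q]_y clamp K (X y).
have mcl Z : measurable_fun setT Z -> measurable_fun setT (fun x : T => clamp K (Z x)).
  by move=> mZ; apply: measurableT_comp => //; exact: measurable_clamp.
have icl Z : measurable_fun setT Z -> Q.-integrable setT (EFin \o (fun x => clamp K (Z x))).
  move=> mZ; apply: (@integrable_bounded _ _ _ _ _ K); first exact: mcl.
  by move=> x; rewrite ler_norml clamp_bound.
have mcE i : \int[Q]_y clamp K (Xi i y) = mc.
  rewrite /mc /Rintegral; congr fine; apply/esym.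
  apply: (@same_law_integral _ _ _ Q X (Xi i) (fun r => (clamp K r)%:E) setT) => //.
  by apply/measurable_EFinP; exact: measurable_clamp.
pose avgc x := (\sum_i clamp K (Xi i x)) / N.+1%:R.
have [isum esum] := Rintegral_sum (fun i => icl (Xi i) (mXi i)).
have mavgc : \int[Q]_y (\sum_i clamp K (Xi i y)) = N.+1%:R * mc.
  by rewrite esum (eq_bigr _ (fun i _ => mcE i)) sumr_const card_ord mulr_natl.
have avgc_mc x : `|avgc x - mc| <= eta / 2.
  have c1 (r : R) : \int[Q]_y (cst r y) = r.
    by rewrite Rintegral_cst// fprobT mulr1.
  have ic (r : R) : Q.-integrable setT (EFin \o cst r) by exact: finite_measure_integrable_cst.
  (* The oscillation bound is integrated in its second point y, the first point x being fixed. *)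
  have le1 : \sum_i clamp K (Xi i x) <= N.+1%:R * mc + 2 * K.
    rewrite -mavgc -[X in X <= _]c1 -[X in _ <= _ + X]c1 -RintegralD//.
    apply: le_Rintegral => //; last by move=> y _; exact: osc.
    rewrite (_ : EFin \o _ = (EFin \o (fun y => \sum_i clamp K (Xi i y))%R) \+ (EFin \o cst (2 * K)%R))%E//.
    exact: integrableD.
  have le2 : N.+1%:R * mc <= \sum_i clamp K (Xi i x) + 2 * K.
    rewrite -mavgc -[X in _ <= X]c1.
    by apply: le_Rintegral => // y _; exact: osc.
  have e1 : avgc x - mc = (\sum_i clamp K (Xi i x) - N.+1%:R * mc) / N.+1%:R.
    by rewrite /avgc mulrBl [_ * mc]mulrC mulfK// gt_eqF.
  rewrite e1 normrM [`|_^-1|]gtr0_norm ?invr_gt0//.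
  apply: le_trans NK; rewrite ler_pM2r ?invr_gt0// ler_norml.
  by apply/andP; split; lra.
have mcm : `|mc - m| <= eta / 2.
  rewrite distrC /m /mc -RintegralB//; last exact: icl.
  have it : Q.-integrable setT (EFin \o (fun x => X x - clamp K (X x))).
    rewrite (_ : EFin \o _ = (EFin \o X) \- (EFin \o (fun x => clamp K (X x))%R))%E//.
    by apply: integrableB => //; exact: icl.
  apply: le_trans (le_normr_Rintegral _ it) _ => //.
  rewrite -lee_fin fineK; first exact: ltW.
  rewrite ge0_fin_numE; first by rewrite (lt_trans int2)// ltry.
  exact: integral_ge0.
have avgc_m x : `|avgc x - m| <= eta.
  rewrite -(subrKA mc) (le_trans (ler_normD _ _))//.
  by have := avgc_mc x; have := mcm; lra.
have mavg : measurable_fun setT (fun x => (\sum_i Xi i x) / N.+1%:R - m).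
  apply: measurable_funB => //; apply: measurable_funM => //.
  exact: measurable_sum.
have mS : measurable_fun setT (fun x => \sum_i (Phi (`|tail K (Xi i x)| / l))%:E)%E.
  apply: emeasurable_sum => i; apply: measurable_orliczE => //.
  exact: measurableT_comp.
apply: (@le_trans _ _ (\int[Q]_x ((e / 2)%:E +
    ((2 * N.+1%:R)^-1)%:E * (\sum_i (Phi (`|tail K (Xi i x)| / l))%:E)))%E).
  apply: ge0_le_integral => //.
  - by move=> x _; rewrite lee_fin orlicz_norm_ge0// mulr_ge0.
  - by apply: measurable_orliczE => //; rewrite mulr_ge0.
  - by apply: emeasurable_funD => //; exact: measurable_funeM.
  move=> x _; rewrite sumEFin -EFinM -EFinD lee_fin.
  (* At the scale 2 l the error is at most (s + B) / 2, with [s] for the truncated part and [B] for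
     the tails, so its modular density is at most (Phi s + Phi B) / 2. *)
  set B := (\sum_i `|tail K (Xi i x)| / l) / N.+1%:R.
  have B0 : 0 <= B by rewrite divr_ge0// sumr_ge0// => i _; rewrite divr_ge0.
  have h : `|(\sum_i Xi i x) / N.+1%:R - m| / (2 * l) <= (s + B) / 2.
    have -> : (\sum_i Xi i x) / N.+1%:R - m =
       (avgc x - m) + (\sum_i tail K (Xi i x)) / N.+1%:R.
      by rewrite /avgc /tail sumrB; ring.
    rewrite ler_pdivrMr ?mulr_gt0//.
    have -> : (s + B) / 2 * (2 * l) = eta + (\sum_i `|tail K (Xi i x)|) / N.+1%:R.
      by rewrite /B /eta -mulr_suml; field; rewrite !gt_eqF.
    rewrite (le_trans (ler_normD _ _))// lerD// normrM [`|_^-1|]gtr0_norm ?invr_gt0//.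
    by rewrite ler_pM2r ?invr_gt0// ler_norm_sum.
  apply: (le_trans (orlicz_le hPhi _ h)); first by rewrite divr_ge0// mulr_ge0.
  apply: (le_trans (orlicz_mean2 hPhi (ltW s0) B0)).
  have := orlicz_jensen_sum (fun i => divr_ge0 (normr_ge0 (tail K (Xi i x))) l0').
  rewrite -/B => h2.
  have -> (u : R) : (2 * N.+1%:R)^-1 * u = (u / N.+1%:R) / 2 by rewrite invfM; ring.
  by rewrite mulrDl; apply: lerD; rewrite ler_pM2r.
rewrite ge0_integralD//; last 3 first.
- by move=> x _; rewrite lee_fin divr_ge0// ltW.
- move=> x _; apply: mule_ge0; first by rewrite lee_fin invr_ge0 mulr_ge0.
  by apply: sume_ge0 => i _; rewrite lee_fin orlicz_norm_ge0.
- exact: measurable_funeM.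
rewrite integral_cst//= probability_setT mule1.
rewrite ge0_integralZl_EFin//; last first.
  by move=> x _; apply: sume_ge0 => i _; rewrite lee_fin orlicz_norm_ge0.
rewrite ge0_integral_sum//; last 2 first.
- by move=> i; apply: measurable_orliczE => //; exact: measurableT_comp.
- by move=> i x _; rewrite lee_fin orlicz_norm_ge0.
apply: (@le_trans _ _ ((e / 2)%:E + ((2 * N.+1%:R)^-1)%:E * (\sum_(i < N.+1) e%:E))%E).
  rewrite leeD2l// lee_wpmul2l ?lee_fin ?invr_ge0 ?mulr_ge0//.
  apply: lee_sum => i _.
  rewrite -(@same_law_ge0_integral _ _ _ Q X (Xi i) (fun r => (Phi (`|tail K r| / l))%:E) setT)//.
  - exact: ltW.
  - exact: (measurable_orliczE hPhi l0' (mtail K)).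
  - by move=> r; rewrite lee_fin orlicz_norm_ge0.
rewrite sumEFin sumr_const card_ord -EFinM -EFinD lee_fin -mulr_natl.
rewrite le_eqVlt; apply/orP; left; apply/eqP; field.
by rewrite nat1r pnatr_eq0.
Qed.

End rearrangement_modular.

(** * Averaging over a cell *)

Section conditional_probability.
Context (d : measure_display) (T : measurableType d) (R : realType)
  (P : probability T R) (A : set T) (mA : measurable A).
Local Notation q A := (fine (P A)).
Hypothesis A0 : 0 < q A.

(** The conditional probability P(. | A). The last argument is the fallback for a null cell, a case
    excluded by [A0] in the lemmas. *)
Definition condprob : probability T R := mnormalize (mrestr P mA) P.

Lemma condprobE B : measurable B -> condprob B = (q (B `&` A) / q A)%:E.
Proof.
move=> mB; rewrite /condprob /= /mnormalize /= /mrestr setTI.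
rewrite ifF; last first.
  by rewrite -(fine_prob P mA) orbF eqe gt_eqF.
by rewrite /mrestr -(fine_prob P (measurableI _ _ mB mA)).
Qed.

Lemma condprob_nonatomic : nonatomic P -> nonatomic condprob.
Proof.
move=> naP B mB; rewrite condprobE// lte_fin => B0.
have BA0 : (0 < P (B `&` A))%E.
  rewrite -(fine_prob P (measurableI _ _ mB mA)) lte_fin.
  by move: B0; rewrite pmulr_lgt0// invr_gt0.
have [C [mC CBA C0 CltB]] := naP _ (measurableI _ _ mB mA) BA0.
have CA : C `&` A = C by apply/setIidl => x /CBA[].
exists C; split => //; first by move=> x /CBA[].
  rewrite condprobE// CA lte_fin divr_gt0//.
  by move: C0; rewrite -(fine_prob P mC).
rewrite !condprobE// CA lte_fin ltr_pM2r ?invr_gt0//.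
by rewrite -lte_fin !fine_prob//; exact: measurableI.
Qed.

Lemma ge0_integral_condprob (f : T -> \bar R) : measurable_fun setT f ->
  (forall x, 0 <= f x)%E ->
  (\int[condprob]_x f x = (q A)^-1%:E * \int[P]_(x in A) f x)%E.
Proof.
move=> mf f0.
have kge0 : 0 <= (q A)^-1 by rewrite invr_ge0 ltW.
have null : condprob (~` A) = 0%E.
  by rewrite condprobE ?setICl ?measure0 ?mul0r//; exact: measurableC.
rewrite (@ge0_negligible_integral _ _ _ condprob setT (~` A))//; last exact: measurableC.
rewrite setTD setCK (eq_measure_integral (mscale (NngNum kge0) P)); last first.
  move=> B mB BA; rewrite [LHS]condprobE// (setIidl BA) /mscale /=.
  by rewrite mulrC EFinM (fine_prob P mB).
by rewrite ge0_integral_mscale//; exact: measurable_funTS.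
Qed.

Lemma integral_condprob (X : T -> R) : P.-integrable setT (EFin \o X) ->
  condprob.-integrable setT (EFin \o X) /\
  \int[condprob]_x X x = (\int[P]_(x in A) X x) / q A.
Proof.
move=> iX; have mX : measurable_fun setT (EFin \o X) by exact: measurable_int iX.
have iA : P.-integrable A (EFin \o X) by exact: integrableS iX.
split.
  apply/integrableP; split => //.
  rewrite ge0_integral_condprob//; last exact: measurableT_comp.
  by rewrite lte_mul_pinfty ?lee_fin ?invr_ge0 ?(ltW A0)//; case/integrableP : iA.
have p1 := integrable_pos_fin_num mA iA; have p2 := integrable_neg_fin_num mA iA.
have e : (\int[condprob]_x (EFin \o X) x = (q A)^-1%:E * \int[P]_(x in A) (EFin \o X) x)%E.
  rewrite [LHS]integralE (ge0_integral_condprob (measurable_funepos mX) (funepos_ge0 _)).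
  rewrite (ge0_integral_condprob (measurable_funeneg mX) (funeneg_ge0 _)).
  rewrite [X in _ = (_ * X)%E]integralE -(fineK p1) -(fineK p2).
  exact: (congr1 EFin (esym (mulrBr _ _ _))).
rewrite /Rintegral [X in fine X = _]e fineM//; last exact: integrable_fin_num.
exact: mulrC.
Qed.

End conditional_probability.

Section cell_average.
Context (d : measure_display) (T : measurableType d) (R : realType)
  (P : probability T R).
Local Notation q A := (fine (P A)).
Implicit Types (A : set T) (X Y : T -> R).

(* On a null cell the division gives the value 0. *)
Definition cellavg A X : T -> R :=
  fun x => if x \in A then (\int[P]_(y in A) X y) / q A else X x.

Lemma measurable_cellavg A X : measurable A -> measurable_fun setT X ->
  measurable_fun setT (cellavg A X).
Proof.
move=> mA mX; apply: measurable_fun_ifT => //.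
apply: (measurable_fun_bool true); rewrite setTI (_ : _ @^-1` _ = A)//.
by apply/seteqP; split => x /= => [/set_mem|/mem_set].
Qed.

(** A law is the sum of its contributions from A and from the complement; only the first is
    modified, and it is determined by the conditional law. *)
Lemma same_law_glue A X Y (mA : measurable A) (A0 : 0 < q A) :
  measurable_fun setT X -> measurable_fun setT Y ->
  same_law (condprob P mA) X Y ->
  same_law P X (fun x => if x \in A then Y x else X x).
Proof.
move=> mX mY XY B mB.
have mXB : measurable (X @^-1` B) by rewrite -[X in measurable X]setTI; exact: mX.
have mYB : measurable (Y @^-1` B) by rewrite -[X in measurable X]setTI; exact: mY.
have -> : (fun x => if x \in A then Y x else X x) @^-1` B =
    (Y @^-1` B `&` A) `|` (X @^-1` B `\` A).
  apply/seteqP; split => x /=.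
    by case: ifPn => [/set_mem|/negP xA]; [left|right; split => // Ax; apply: xA; exact/mem_set].
  by move=> [[h /mem_set ->//]|[h nA]]; rewrite ifF//; apply/negP => /set_mem.
have e : q (X @^-1` B `&` A) = q (Y @^-1` B `&` A).
  have := XY B mB; rewrite !condprobE// => -[] /(mulIf _); apply.
  by rewrite invr_neq0// gt_eqF.
have U (C D : set T) : measurable C -> measurable D ->
    P ((C `&` A) `|` (D `\` A)) = (P (C `&` A) + P (D `\` A))%E.
  move=> mC mD; apply: measureU; [exact: measurableI|exact: measurableD|].
  by apply/seteqP; split => // x [[_ Ax] [_]].
have e2 : P (X @^-1` B `&` A) = P (Y @^-1` B `&` A).
  by rewrite -(fine_prob P (measurableI _ _ mXB mA)) -(fine_prob P (measurableI _ _ mYB mA)) e.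
by rewrite (U _ _ mYB mXB) -e2 -(U _ _ mXB mXB) setUIDK.
Qed.

Variables (Phi : R -> R) (hPhi : orlicz_function Phi).

(** The copies are built under the conditional probability and extended by X outside A, where their
    mean is X and the error is 0. On A the error integral is the conditional one times q A <= 1. *)
Lemma cellavg_modular A X (l e : R) : nonatomic P -> measurable A -> 0 < q A ->
  measurable_fun setT X -> P.-integrable setT (EFin \o X) ->
  0 < l -> (\int[P]_x (Phi (`|X x| / l))%:E < +oo)%E -> 0 < e ->
  exists (N : nat) (Xi : 'I_N.+1 -> T -> R),
    [/\ (forall i, measurable_fun setT (Xi i)), (forall i, same_law P X (Xi i)) &
     (\int[P]_x (Phi (`|(\sum_i Xi i x) / N.+1%:R - cellavg A X x| / (2 * l)))%:E
       <= e%:E)%E].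
Proof.
move=> naP mA A0 mX iX l0 Xl e0; have l0' := ltW l0.
have [iQ mQ] := integral_condprob mA A0 iX.
have Ql : (\int[condprob P mA]_x (Phi (`|X x| / l))%:E < +oo)%E.
  have f0 x : (0 <= (Phi (`|X x| / l))%:E)%E by rewrite lee_fin orlicz_norm_ge0.
  have mf := measurable_orliczE hPhi l0' mX.
  rewrite ge0_integral_condprob// lte_mul_pinfty ?lee_fin ?invr_ge0 ?(ltW A0)//.
  by apply: le_lt_trans Xl; apply: ge0_subset_integral.
have [N [Xi [mXi XXi Xie]]] := rearrangement_modular hPhi (condprob_nonatomic A0 naP) mX iQ l0 Ql e0.
exists N, (fun i x => if x \in A then Xi i x else X x); split.
- move=> i; apply: measurable_fun_ifT => //.
  apply: (measurable_fun_bool true); rewrite setTI (_ : _ @^-1` _ = A)//.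
  by apply/seteqP; split => x /= => [/set_mem|/mem_set].
- by move=> i; exact: same_law_glue.
set m := \int[condprob P mA]_y X y in Xie.
pose h x := (Phi (`|(\sum_i Xi i x) / N.+1%:R - m| / (2 * l)))%:E.
have mh : measurable_fun setT h.
  apply: measurable_orliczE => //; first by rewrite mulr_ge0.
  apply: measurable_funB => //; apply: measurable_funM => //; exact: measurable_sum.
have h0 x : (0 <= h x)%E by rewrite lee_fin orlicz_norm_ge0// mulr_ge0.
have -> : (\int[P]_x (Phi (`|(\sum_i (if x \in A then Xi i x else X x)) / N.+1%:R
     - cellavg A X x| / (2 * l)))%:E = \int[P]_(x in A) h x)%E.
  rewrite [RHS]integral_mkcond; apply: eq_integral => x _.
  rewrite patchE /cellavg; case: ifPn => xA; first by rewrite /h /m mQ.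
  have -> : (\sum_(i < N.+1) X x) / N.+1%:R = X x.
    by rewrite sumr_const card_ord -[_ *+ _]mulr_natl mulrAC divff// mul1r.
  by rewrite subrr normr0 mul0r orlicz_0.
have := Xie; rewrite -/h ge0_integral_condprob// => he.
apply: le_trans he; rewrite -[leLHS]mul1e; apply: lee_wpmul2r.
  by apply: integral_ge0 => x _; exact: h0.
by rewrite lee_fin invf_ge1// fprob_le1.
Qed.

End cell_average.

(** * Dilatation monotonicity for one cell *)

Section dilatation.
Context (d : measure_display) (T : measurableType d) (R : realType)
  (P : probability T R).
Local Notation q A := (fine (P A)).
Implicit Types (A : set T) (X Y Z : T -> R).

(** Stated for a predicate so that membership in the space and a bound on [rho] can be carried
    through the induction together. *)
Lemma convex_closed_avg (E : (T -> R) -> Prop) :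
  (forall X Y l, E X -> E Y -> 0 <= l <= 1 -> E (fun x => l * X x + (1 - l) * Y x)) ->
  forall n (Xi : 'I_n.+1 -> T -> R), (forall i, E (Xi i)) ->
  E (fun x => (\sum_i Xi i x) / n.+1%:R).
Proof.
move=> HE; elim=> [|n IH] Xi EXi.
  rewrite (_ : (fun x => _) = Xi ord0)//.
  by apply/funext => x; rewrite big_ord1 divr1.
have N0 : 0 < n.+1%:R :> R by [].
have N2 : n.+2%:R = n.+1%:R + 1 :> R by rewrite natr1.
pose c : R := n.+1%:R / n.+2%:R.
have c01 : 0 <= c <= 1 by rewrite /c divr_ge0//= ler_pdivrMr// mul1r N2; lra.
have mix (p u v : R) : 0 < p -> p / (p + 1) * (u / p) + (1 - p / (p + 1)) * v = (u + v) / (p + 1).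
  move=> p0; have p1 : p + 1 != 0 by apply: lt0r_neq0; lra.
  by field; rewrite p1 gt_eqF.
have := HE _ _ c (IH (fun i => Xi (widen_ord (leqnSn _) i)) (fun i => EXi _)) (EXi ord_max) c01.
rewrite (_ : (fun x => _) = (fun x => (\sum_i Xi i x) / n.+2%:R))//.
by apply/funext => x; rewrite [in RHS]big_ord_recr /= /c N2 mix.
Qed.

Lemma convex_mix_le (rho : (T -> R) -> \bar R) (E : (T -> R) -> Prop) (c : \bar R) X Y (l : R) :
  convex_on E rho -> c != -oo%E -> E X -> E Y -> (rho X <= c)%E -> (rho Y <= c)%E ->
  0 <= l <= 1 -> (rho (fun x => l * X x + (1 - l) * Y x)%R <= c)%E.
Proof.
move=> crho cNy EX EY Xc Yc l01; have /andP[l0 l1] := l01.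
case: c cNy Xc Yc => [r| |] // _ Xc Yc; last exact: leey.
apply: le_trans (crho X Y l EX EY l01) _.
apply: (@le_trans _ _ (l%:E * r%:E + (1 - l)%:E * r%:E)%E).
  by apply: leeD; rewrite lee_wpmul2l// lee_fin// subr_ge0.
by rewrite -!EFinM -EFinD lee_fin -mulrDl; lra.
Qed.

Lemma Linfty_mix (c : R) X Y (l : R) :
  measurable_fun setT X /\ {ae P, forall x, `|X x| <= c} ->
  measurable_fun setT Y /\ {ae P, forall x, `|Y x| <= c} -> 0 <= l <= 1 ->
  measurable_fun setT (fun x => l * X x + (1 - l) * Y x) /\
  {ae P, forall x, `|l * X x + (1 - l) * Y x| <= c}.
Proof.
move=> [mX Xc] [mY Yc] /andP[l0 l1]; split.
  by apply: measurable_funD; apply: measurable_funM.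
near=> x; have h1 : `|X x| <= c by near: x. have h2 : `|Y x| <= c by near: x.
rewrite (le_trans (ler_normD _ _))// !normrM (ger0_norm l0) (@ger0_norm _ (1 - l)) ?subr_ge0//.
have l1' : 0 <= 1 - l by rewrite subr_ge0.
have := ler_wpM2l l0 h1; have := ler_wpM2l l1' h2; lra.
Unshelve. all: by end_near. Qed.

Lemma same_law_bounded X Z (c : R) : measurable_fun setT X -> measurable_fun setT Z ->
  same_law P X Z -> {ae P, forall x, `|X x| <= c} -> {ae P, forall x, `|Z x| <= c}.
Proof.
move=> mX mZ XZ Xc.
pose B := [set r : R | ~ (`|r| <= c)].
have mB : measurable B.
  rewrite (_ : B = ~` [set r | `|r| <= c]); last by apply/seteqP; split.
  apply: measurableC; rewrite -[X in measurable X]setTI; apply: measurable_fun_le => //.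
have mXB : measurable (X @^-1` B) by rewrite -[X in measurable X]setTI; exact: mX.
have mZB : measurable (Z @^-1` B) by rewrite -[X in measurable X]setTI; exact: mZ.
have X0 : P (X @^-1` B) = 0%E by exact: (measure_negligible mXB Xc).
exists (Z @^-1` B); split => //; by rewrite -(XZ _ mB).
Qed.

Lemma LPhi_mix (Phi : R -> R) (hPhi : orlicz_function Phi) X Y (l : R) :
  LPhi P Phi X -> LPhi P Phi Y -> LPhi P Phi (fun x => l * X x + (1 - l) * Y x).
Proof. by move=> LX LY; apply: LPhi_add => //; exact: LPhi_scale. Qed.

Variables (Phi : R -> R) (hPhi : orlicz_function Phi).

Lemma same_law_LPhi X Z : measurable_fun setT Z -> same_law P X Z ->
  LPhi P Phi X -> LPhi P Phi Z.
Proof.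
move=> mZ XZ [mX [l [l0 Xl]]]; split => //; exists l; split => //.
have l0' := ltW l0; apply: le_trans Xl; rewrite le_eqVlt; apply/orP; left; apply/eqP/esym.
apply: (@same_law_ge0_integral _ _ _ P X Z (fun r => (Phi (`|r| / l))%:E) setT) => //.
- by apply: (measurable_orliczE hPhi l0' (@measurable_id _ _ setT)).
- by move=> r; rewrite lee_fin orlicz_norm_ge0.
Qed.

Lemma LPhi_cellavg A X : measurable A -> LPhi P Phi X -> LPhi P Phi (cellavg P A X).
Proof.
move=> mA LX; have [mX _] := LX.
pose c := (\int[P]_(y in A) X y) / q A.
apply: (@LPhi_le _ _ _ _ _ hPhi _ (fun x => `|X x| + `|c|)).
- exact: measurable_cellavg.
- by apply: LPhi_add => //; [exact: LPhi_norm|exact: LPhi_cst].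
- apply: aeW => x; rewrite /cellavg -/c; case: ifPn => _.
    by rewrite lerDr.
  by rewrite lerDl.
Qed.

Definition law_avg X Z := exists (N : nat) (Xi : 'I_N.+1 -> T -> R),
  [/\ (forall i, measurable_fun setT (Xi i)), (forall i, same_law P X (Xi i)) &
      Z = (fun x => (\sum_i Xi i x) / N.+1%:R)].

(** Errors 2 ^ (-(n + 1)) in [cellavg_modular] are summable, so [modular_dominated_cvg] supplies the
    mode of convergence required by the Fatou property. *)
Lemma cellavg_approx A X : nonatomic P -> measurable A -> 0 < q A -> LPhi P Phi X ->
  exists Z : nat -> T -> R, [/\ forall n, law_avg X (Z n),
    {ae P, forall x, (fun n => Z n x) @ \oo --> cellavg P A X x} &
    exists Y, LPhi P Phi Y /\ forall n, {ae P, forall x, `|Z n x| <= Y x}].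
Proof.
move=> naP mA A0 LX; have [mX [l [l0 Xl]]] := LX.
have Xly : (\int[P]_x (Phi (`|X x| / l))%:E < +oo)%E by rewrite (le_lt_trans Xl)// ltry.
have H n : exists Z, law_avg X Z /\
   (\int[P]_x (Phi (`|Z x - cellavg P A X x| / (2 * l)))%:E <= (1 / (2 ^ n.+1)%:R)%:E)%E.
  have e0 : 0 < 1 / (2 ^ n.+1)%:R :> R by rewrite divr_gt0// ltr0n expn_gt0.
  have [N [Xi [mXi XXi Xie]]] := cellavg_modular hPhi naP mA A0 mX (LPhi_integrable hPhi LX) l0 Xly e0.
  by exists (fun x => (\sum_i Xi i x) / N.+1%:R); split => //; exists N, Xi.
have [Z ZP] := choice H.
have mZ n : measurable_fun setT (Z n).
  have [[N [Xi [mXi _ ->]]] _] := ZP n.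
  apply: measurable_funM => //; exact: measurable_sum.
have l20 : 0 < 2 * l by rewrite mulr_gt0.
have [Zc Zd] := modular_dominated_cvg hPhi l20 mZ (LPhi_cellavg mA LX) (fun n => proj2 (ZP n)).
by exists Z; split => // n; case: (ZP n).
Qed.

Lemma cellavg_null A X : measurable A -> q A = 0 -> measurable_fun setT X ->
  same_law P X (cellavg P A X).
Proof.
move=> mA A0 mX B mB.
have mC : measurable (cellavg P A X @^-1` B).
  by rewrite -[X in measurable X]setTI; exact: measurable_cellavg.
have mXB : measurable (X @^-1` B) by rewrite -[X in measurable X]setTI; exact: mX.
rewrite -(fine_prob P mXB) -(fine_prob P mC); congr (_%:E).
apply: (@fprob_eq_outside_null _ _ _ P _ _ A) => // x nA.
by rewrite /preimage /cellavg /= ifF//; apply/negP => /set_mem.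
Qed.

(** Convexity and law-invariance bound [rho] by rho X at every mean of copies of X, and the Fatou
    property passes this bound to the limit. Over a null cell, averaging does not change the law. *)
Lemma dilatation_LPhi (rho : (T -> R) -> \bar R) A X : nonatomic P ->
  proper_on (LPhi P Phi) rho -> convex_on (LPhi P Phi) rho ->
  law_invariant_on P (LPhi P Phi) rho -> fatou_on P (LPhi P Phi) rho ->
  measurable A -> LPhi P Phi X -> (rho (cellavg P A X) <= rho X)%E.
Proof.
move=> naP [rhoNy _] crho lrho frho mA LX; have [mX _] := LX.
have LC := LPhi_cellavg mA LX.
have [A0|A0] := eqVneq (q A) 0.
  by rewrite (lrho _ _ LX LC)//; exact: cellavg_null.
have {}A0 : 0 < q A by rewrite lt_neqAle eq_sym A0 fprob_ge0.
have [Z [ZX Zc [Y [LY ZY]]]] := cellavg_approx naP mA A0 LX.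
have HZ n : LPhi P Phi (Z n) /\ (rho (Z n) <= rho X)%E.
  have [N [Xi [mXi XXi ->]]] := ZX n.
  have LXi i : LPhi P Phi (Xi i) by exact: (same_law_LPhi (mXi i) (XXi i)).
  apply: (@convex_closed_avg (fun Z => LPhi P Phi Z /\ (rho Z <= rho X)%E)).
    move=> U V t [LU Uc] [LV Vc] t01; split; first exact: LPhi_mix.
    by apply: (convex_mix_le crho) => //; exact: rhoNy.
  by move=> i; split => //; rewrite (lrho _ _ LX (LXi i) (XXi i)).
apply: le_trans (frho Z _ Y _ LC LY Zc ZY) _; first by move=> n; case: (HZ n).
by apply: limn_einf_le => n; case: (HZ n).
Qed.

Lemma bounded_cellavg A X (c : R) : measurable A -> measurable_fun setT X ->
  {ae P, forall x, `|X x| <= c} -> {ae P, forall x, `|cellavg P A X x| <= c}.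
Proof.
move=> mA mX Xc.
have [A0|A0] := eqVneq (q A) 0.
  apply: (same_law_bounded mX _ _ Xc); first exact: measurable_cellavg.
  exact: cellavg_null.
have {}A0 : 0 < q A by rewrite lt_neqAle eq_sym A0 fprob_ge0.
have iX : P.-integrable setT (EFin \o X).
  by apply: (LPhi_integrable hPhi); apply: Linfty_LPhi => //; split => //; exists c.
have iA : P.-integrable A (EFin \o X) by exact: integrableS iX.
have b : `|(\int[P]_(y in A) X y) / q A| <= c.
  rewrite normrM normfV (gtr0_norm A0) ler_pdivrMr//.
  rewrite -lee_fin EFin_normr_Rintegral//.
  apply: le_trans (le_abse_integral _ mA (measurable_int _ iA)) _.
  apply: (@le_trans _ _ (\int[P]_(x in A) (cst c%:E x))%E); last first.
    by rewrite integral_cst// EFinM (fine_prob P mA).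
  (* An event of probability 1 is nonempty, so the bound holds at some point. *)
  have c0 : 0 <= c.
    have P0 : (0 < P setT)%E by rewrite probability_setT lte01.
    have [x hx] := @filter_ex _ _ (ae_properfilter_algebraOfSetsType P0) _ Xc.
    exact: le_trans hx.
  apply: ae_ge0_le_integral => //.
  - by apply: measurableT_comp => //; exact: measurable_int iA.
  - apply: filterS Xc => x Xx _ /=; by rewrite lee_fin.
apply: filterS Xc => x Xx; rewrite /cellavg; by case: ifPn.
Qed.

Lemma Linfty_cellavg A X : measurable A -> Linfty P X -> Linfty P (cellavg P A X).
Proof.
move=> mA [mX [c Xc]]; split; first exact: measurable_cellavg.
by exists c; exact: bounded_cellavg.
Qed.

(** The same approximation is used, but domination must now be by a bounded variable: copies of X
    and their means keep its essential bound c, and the constant c replaces the majorant in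
    L^Phi. *)
Lemma dilatation_Linfty (rho : (T -> R) -> \bar R) A X : nonatomic P ->
  proper_on (Linfty P) rho -> convex_on (Linfty P) rho ->
  law_invariant_on P (Linfty P) rho -> fatou_on P (Linfty P) rho ->
  measurable A -> Linfty P X -> (rho (cellavg P A X) <= rho X)%E.
Proof.
move=> naP [rhoNy _] crho lrho frho mA LX; have [mX [c Xc]] := LX.
have LC := Linfty_cellavg mA LX.
have [A0|A0] := eqVneq (q A) 0.
  by rewrite (lrho _ _ LX LC)//; exact: cellavg_null.
have {}A0 : 0 < q A by rewrite lt_neqAle eq_sym A0 fprob_ge0.
have [Z [ZX Zc _]] := cellavg_approx naP mA A0 (Linfty_LPhi hPhi LX).
pose Ec Z := measurable_fun setT Z /\ {ae P, forall x, `|Z x| <= c}.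
have Ecl U : Ec U -> Linfty P U by move=> [mU Uc]; split => //; exists c.
have HZ n : Ec (Z n) /\ (rho (Z n) <= rho X)%E.
  have [N [Xi [mXi XXi ->]]] := ZX n.
  have LXi i : Ec (Xi i) by split; [exact: mXi|exact: (same_law_bounded mX (mXi i) (XXi i) Xc)].
  apply: (@convex_closed_avg (fun Z => Ec Z /\ (rho Z <= rho X)%E)).
    move=> U V t [LU Uc] [LV Vc] t01; split; first exact: Linfty_mix.
    by apply: (convex_mix_le crho) => //; [exact: rhoNy|exact: Ecl|exact: Ecl].
  by move=> i; split => //; rewrite (lrho _ _ LX (Ecl _ (LXi i)) (XXi i)).
have Lc : Linfty P (cst c).
  by split; [exact: measurable_cst|exists `|c|; apply: aeW].
apply: le_trans (frho Z _ (cst c) _ LC Lc Zc _) _.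
- by move=> n; apply: Ecl; case: (HZ n).
- by move=> n; case: (HZ n) => -[].
by apply: limn_einf_le => n; case: (HZ n).
Qed.

End dilatation.

(** * Successive averages over several cells *)

Section iterated_averages.
Context (d : measure_display) (T : measurableType d) (R : realType)
  (P : probability T R).
Local Notation q A := (fine (P A)).
Implicit Types (X Y Z : T -> R) (A : nat -> set T).

(** Cells are treated in order, [A 0] first, and may overlap; linearity, contraction in L^1 and
    dilatation monotonicity pass from one cell to all by induction. *)
Fixpoint iter_avg A n X : T -> R :=
  if n is m.+1 then cellavg P (A m) (iter_avg A m X) else X.

(** Averaging contracts L^1: on A the new norm is the absolute value of the integral of X, and
    outside A nothing changes. *)
Lemma integrable_cellavg (A : set T) X : measurable A ->
  P.-integrable setT (EFin \o X) ->
  P.-integrable setT (EFin \o cellavg P A X) /\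
  \int[P]_x `|cellavg P A X x| <= \int[P]_x `|X x|.
Proof.
move=> mA iX; have mX : measurable_fun setT X.
  by apply/measurable_EFinP; exact: measurable_int iX.
have mC := measurable_cellavg P mA mX.
pose c := (\int[P]_(y in A) X y) / q A.
have iC : P.-integrable setT (EFin \o cellavg P A X).
  apply: (@le_integrable _ _ _ _ _ _ _ (EFin \o (fun x => `|X x| + `|c|))) => //.
  - exact/measurable_EFinP.
  - move=> x _ /=; rewrite lee_fin [leRHS]ger0_norm ?addr_ge0//.
    by rewrite /cellavg -/c; case: ifPn => _; rewrite ?lerDr// lerDl.
  - rewrite (_ : EFin \o _ = (EFin \o (fun x => `|X x|)%R) \+ (EFin \o cst `|c|%R))%E//.
    apply: integrableD => //; first exact: integrable_norm.
    exact: finite_measure_integrable_cst.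
split => //.
have UA : [set: T] = A `|` ~` A by rewrite setUv.
have dA : [disjoint A & ~` A] by apply/disj_setPS; rewrite setICr.
have mAc := measurableC mA.
have S f : P.-integrable setT (EFin \o f) ->
    \int[P]_x f x = \int[P]_(x in A) f x + \int[P]_(x in ~` A) f x.
  by move=> fi; rewrite [in LHS]UA Rintegral_setU// -UA.
rewrite (S _ (integrable_norm iC)) (S _ (integrable_norm iX)).
apply: lerD.
  have -> : \int[P]_(x in A) `|cellavg P A X x| = \int[P]_(x in A) cst `|c| x.
    by apply: eq_Rintegral => x xA; rewrite /cellavg ifT.
  rewrite Rintegral_cst// /c normrM normfV (ger0_norm (fprob_ge0 P A)).
  have [->|A0] := eqVneq (q A) 0; first by rewrite mulr0; apply: Rintegral_ge0 => x _; exact: normr_ge0.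
  by rewrite mulfVK// le_normr_Rintegral//; exact: integrableS iX.
rewrite le_eqVlt; apply/orP; left; apply/eqP; apply: eq_Rintegral => x.
by rewrite inE => nA; rewrite /cellavg /= ifF//; apply/negP => /set_mem.
Qed.

Lemma cellavg_lin (A : set T) X Y (a b : R) : measurable A ->
  P.-integrable setT (EFin \o X) -> P.-integrable setT (EFin \o Y) ->
  cellavg P A (fun x => a * X x + b * Y x) =
  (fun x => a * cellavg P A X x + b * cellavg P A Y x).
Proof.
move=> mA iX iY; apply/funext => x; rewrite /cellavg; case: ifPn => // _.
have iXA : P.-integrable A (EFin \o X) by exact: integrableS iX.
have iYA : P.-integrable A (EFin \o Y) by exact: integrableS iY.
have iZ (c : R) Z : P.-integrable A (EFin \o Z) -> P.-integrable A (EFin \o (fun x => c * Z x)).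
  by move=> /(integrableZl mA c).
rewrite RintegralD//; [|exact: iZ|exact: iZ].
by rewrite !RintegralZl// mulrDl !mulrA.
Qed.

Lemma integrable_iter_avg A n X : (forall k, measurable (A k)) ->
  P.-integrable setT (EFin \o X) ->
  P.-integrable setT (EFin \o iter_avg A n X) /\
  \int[P]_x `|iter_avg A n X x| <= \int[P]_x `|X x|.
Proof.
move=> mA iX; elim: n => [|n [IHi IHn]] //=.
have [i1 n1] := integrable_cellavg (mA n) IHi; split => //.
exact: le_trans n1 IHn.
Qed.

Lemma iter_avg_lin A n X Y (a b : R) : (forall k, measurable (A k)) ->
  P.-integrable setT (EFin \o X) -> P.-integrable setT (EFin \o Y) ->
  iter_avg A n (fun x => a * X x + b * Y x) =
  (fun x => a * iter_avg A n X x + b * iter_avg A n Y x).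
Proof.
move=> mA iX iY; elim: n => [|n IH] //=; rewrite IH cellavg_lin//.
  by case: (integrable_iter_avg n mA iX).
by case: (integrable_iter_avg n mA iY).
Qed.

Lemma measurable_iter_avg A n X : (forall k, measurable (A k)) ->
  measurable_fun setT X -> measurable_fun setT (iter_avg A n X).
Proof. by move=> mA mX; elim: n => //= n IH; exact: measurable_cellavg. Qed.

Definition covers A n := forall x, exists2 k, (k < n)%N & A k x.

(* On each averaged cell the average is a continuous functional in L^1, hence
   an iterated average over a finite cover maps L^1 into L^oo. *)
Lemma iter_avg_bound A n : (forall k, measurable (A k)) ->
  exists2 C, 0 <= C & forall X, P.-integrable setT (EFin \o X) ->
    forall x k, (k < n)%N -> A k x -> `|iter_avg A n X x| <= C * \int[P]_x `|X x|.
Proof.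
move=> mA; elim: n => [|n [C C0 IH]]; first by exists 0.
have v0 : 0 <= (q (A n))^-1 by rewrite invr_ge0 fprob_ge0.
(* A point of the last cell takes the value of a mean over it, whose numerator is controlled by
   contraction in L^1; any other covered point lies in an earlier cell. For a null cell the inverse
   and the value are both 0. *)
exists (C + (q (A n))^-1) => [|X iX x k kn Akx]; first exact: addr_ge0.
have X0 : 0 <= \int[P]_x `|X x| by apply: Rintegral_ge0 => y _; exact: normr_ge0.
rewrite mulrDl /= /cellavg; case: ifPn => [_|/negP nA].
  apply: (@le_trans _ _ ((q (A n))^-1 * \int[P]_x `|X x|)); last first.
    by rewrite lerDr mulr_ge0.
  rewrite normrM (ger0_norm v0) mulrC ler_wpM2l//.
  have [ii ni] := integrable_iter_avg n mA iX.
  apply: le_trans ni.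
  have iA : P.-integrable (A n) (EFin \o iter_avg A n X) by exact: integrableS ii.
  apply: le_trans (le_normr_Rintegral (mA n) iA) _.
  rewrite -lee_fin !fineK.
  - apply: ge0_subset_integral => //.
    by apply/measurable_EFinP; apply: measurableT_comp => //; apply/measurable_EFinP; exact: measurable_int ii.
  - have : P.-integrable setT (EFin \o (fun x => `|iter_avg A n X x|)) by exact: integrable_norm.
    exact: integrable_fin_num.
  - have : P.-integrable (A n) (EFin \o (fun x => `|iter_avg A n X x|)) by exact: integrable_norm.
    exact: integrable_fin_num.
apply: (@le_trans _ _ (C * \int[P]_x `|X x|)); last by rewrite lerDl mulr_ge0.
apply: (IH X iX x k _ Akx).
have : (k <= n)%N by rewrite -ltnS.
rewrite leq_eqVlt => /predU1P[e|//]; exfalso; apply: nA; apply/mem_set.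
by rewrite -e.
Qed.

Lemma iter_avg_untouched A n X j x : trivIset setT A -> (n <= j)%N -> A j x ->
  iter_avg A n X x = X x.
Proof.
move=> tA; elim: n => [//|n IH] nj Ajx /=; rewrite /cellavg ifF; first exact: IH (ltnW nj) Ajx.
apply/negP => /set_mem Anx.
have e : n = j by apply: (tA n j I I); exists x.
by move: nj; rewrite e ltnn.
Qed.

(** A cell disjoint from the others still carries X when its turn comes, and is left alone
    afterwards. *)
Lemma iter_avg_disjoint A n X k x : trivIset setT A -> (k < n)%N -> A k x ->
  iter_avg A n X x = (\int[P]_(y in A k) X y) / q (A k).
Proof.
move=> tA; elim: n => [//|n IH] kn Akx /=; rewrite /cellavg.
move: kn; rewrite ltnS leq_eqVlt => /predU1P[e|kn].
  subst k; rewrite mem_set//; congr (_ / _); apply: eq_Rintegral => y /set_mem Any.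
  exact: (iter_avg_untouched _ tA (leqnn n) Any).
rewrite ifF; first exact: IH.
apply/negP => /set_mem Anx.
have e : n = k by apply: (tA n k I I); exists x.
by move: kn; rewrite e ltnn.
Qed.

(** Over level sets of X every iterate is a function g of X. The constants taken by g are quotients
    of integrals that depend only on the law, so the same g serves for Y. *)
Lemma iter_avg_same_law (B : nat -> set R) n X Y : (forall k, measurable (B k)) ->
  measurable_fun setT X -> measurable_fun setT Y -> same_law P X Y ->
  exists g : R -> R, [/\ measurable_fun setT g,
    iter_avg (fun k => X @^-1` B k) n X = g \o X &
    iter_avg (fun k => Y @^-1` B k) n Y = g \o Y].
Proof.
move=> mB mX mY XY; elim: n => [|n [g [mg gX gY]]]; first by exists id; split.
pose c := (\int[P]_(y in X @^-1` B n) g (X y)) / q (X @^-1` B n).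
exists (fun r => if r \in B n then c else g r); split.
- apply: measurable_fun_ifT => //; apply: (measurable_fun_bool true).
  rewrite setTI (_ : _ @^-1` _ = B n)//.
  by apply/seteqP; split => x /= => [/set_mem|/mem_set].
- rewrite /= gX; apply/funext => x; rewrite /cellavg /=.
  by rewrite (_ : (x \in X @^-1` B n) = (X x \in B n)) //; apply/idP/idP => /set_mem h; exact/mem_set.
- rewrite /= gY; apply/funext => x; rewrite /cellavg /=.
  rewrite (_ : (x \in Y @^-1` B n) = (Y x \in B n)); last first.
    by apply/idP/idP => /set_mem h; exact/mem_set.
  case: ifPn => // _; rewrite /c (XY _ (mB n)); congr (_ / _).
  rewrite /Rintegral; congr fine; apply/esym.
  apply: (@same_law_integral _ _ _ P X Y (fun r => (g r)%:E) (B n)) => //.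
  by apply: measurable_funTS; apply/measurable_EFinP.
Qed.

End iterated_averages.

(** * Jensen's inequality on a cell *)

Section jensen.
Context (d : measure_display) (T : measurableType d) (R : realType)
  (P : probability T R) (Phi : R -> R) (hPhi : orlicz_function Phi).
Local Notation q A := (fine (P A)).

(** The slope is the infimum of the chord slopes to the right of s. Monotonicity makes these
    nonnegative, and convexity puts every chord slope to the left below all of them. *)
Lemma orlicz_support_line (s : R) : 0 <= s ->
  exists2 a, 0 <= a & forall t, 0 <= t -> Phi s + a * (t - s) <= Phi t.
Proof.
move=> s0.
pose S := [set (Phi u - Phi s) / (u - s) | u in [set u | s < u]].
have S0 : S !=set0 by exists ((Phi (s + 1) - Phi s) / (s + 1 - s)), (s + 1) => //=; lra.
have lb0 : lbound S 0.
  move=> _ [u /= su <-]; rewrite divr_ge0//; last by rewrite subr_ge0 ltW.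
  by rewrite subr_ge0 orlicz_le// ltW.
have hl : has_lbound S by exists 0.
exists (inf S) => [|t t0]; first exact: lb_le_inf.
have [st|ts|->] := ltgtP s t; last by rewrite subrr mulr0 addr0.
  have h : inf S <= (Phi t - Phi s) / (t - s) by apply: ge_inf => //; exists t.
  have ts0 : 0 < t - s by rewrite subr_gt0.
  by move: h; rewrite ler_pdivlMr//; lra.
have ts0 : 0 < s - t by rewrite subr_gt0.
have h : (Phi s - Phi t) / (s - t) <= inf S.
  apply: lb_le_inf => // _ [u /= su <-].
  have us0 : 0 < u - s by rewrite subr_gt0.
  have ut0 : 0 < u - t by lra.
  pose c := (u - s) / (u - t).
  have c01 : 0 <= c <= 1.
    apply/andP; split; first by rewrite divr_ge0// ltW.
    by rewrite ler_pdivrMr// mul1r; lra.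
  have u0 : 0 <= u by lra.
  have := orlicz_convex hPhi t0 u0 c01.
  have -> : c * t + (1 - c) * u = s by rewrite /c; field; rewrite gt_eqF.
  have -> : c * Phi t + (1 - c) * Phi u = ((u - s) * Phi t + (s - t) * Phi u) / (u - t).
    by rewrite /c; field; rewrite gt_eqF.
  rewrite ler_pdivlMr// => h.
  rewrite ler_pdivrMr// mulrAC ler_pdivlMr//; lra.
by move: h; rewrite ler_pdivrMr//; lra.
Qed.

(** The supporting line of [Phi] at the mean s of |X| / l over D integrates to Phi s * q D.
    Replacing the mean of X by that of |X| only increases the left-hand side. *)
Lemma orlicz_jensen (D : set T) (X : T -> R) (l : R) : measurable D ->
  P.-integrable setT (EFin \o X) -> 0 < l ->
  ((Phi (`|(\int[P]_(y in D) X y) / q D| / l) * q D)%:E <=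
   \int[P]_(x in D) (Phi (`|X x| / l))%:E)%E.
Proof.
move=> mD iX l0; have l0' := ltW l0.
have mX : measurable_fun setT X by apply/measurable_EFinP; exact: measurable_int iX.
have D0 : 0 <= q D := fprob_ge0 P D.
have [->|Dn0] := eqVneq (q D) 0.
  by rewrite mulr0; apply: integral_ge0 => x _; rewrite lee_fin orlicz_norm_ge0.
have Dgt0 : 0 < q D by rewrite lt_neqAle eq_sym Dn0.
have iD : P.-integrable D (EFin \o X) by exact: integrableS iX.
pose s := (\int[P]_(y in D) `|X y|) / q D / l.
have s0 : 0 <= s by rewrite !divr_ge0//; apply: Rintegral_ge0 => x _; exact: normr_ge0.
have [a a0 line] := orlicz_support_line s0.
apply: (@le_trans _ _ (Phi s * q D)%:E).
  rewrite lee_fin ler_pM2r// orlicz_le// ?divr_ge0//.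
  rewrite ler_pM2r ?invr_gt0// normrM normfV (gtr0_norm Dgt0).
  by rewrite ler_pM2r ?invr_gt0// le_normr_Rintegral.
pose f x := Phi s + a * (`|X x| / l - s).
have inX : P.-integrable D (EFin \o (fun x => `|X x|)) by exact: integrable_norm.
have icst (r : R) : P.-integrable D (EFin \o cst r) by exact: finite_measure_integrable_cst.
have fE : f = (fun x => (a / l) * `|X x| + (Phi s - a * s)).
  by apply/funext => x; rewrite /f; ring.
have i1 : P.-integrable D (EFin \o (fun x => (a / l) * `|X x|)) by exact: integrableZl inX.
have If : P.-integrable D (EFin \o f).
  by rewrite fE; apply: (@integrableD _ _ _ _ _ mD _ _ i1 (icst (Phi s - a * s))).
have -> : (Phi s * q D)%:E = (\int[P]_(x in D) (f x)%:E)%E.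
  rewrite -[RHS]fineK; last exact: integrable_fin_num If.
  congr (_%:E); rewrite -/(Rintegral P D f) fE.
  rewrite (RintegralD mD i1 (icst (Phi s - a * s))) (RintegralZl _ mD inX) (Rintegral_cst _ mD).
  have -> : \int[P]_(x in D) `|X x| = s * l * q D.
    by rewrite /s; field; rewrite Dn0 gt_eqF.
  by field; rewrite gt_eqF.
(* The line may be negative and the integral of [Phi] infinite; comparing with the positive part of
   the line, still below [Phi], keeps all integrands nonnegative. *)
rewrite [leLHS]integralE.
apply: (@le_trans _ _ (\int[P]_(x in D) (EFin \o f)^\+ x)%E).
  rewrite leeBlDr; last exact: integrable_neg_fin_num.
  by rewrite leeDl// integral_ge0.
apply: ge0_le_integral => //.
- by apply: measurable_funepos; exact: measurable_int If.
- by apply: measurable_funTS; exact: measurable_orliczE.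
- move=> x _; rewrite funeposE /= -EFin_max lee_fin ge_max orlicz_norm_ge0// andbT.
  by apply: line; rewrite divr_ge0.
Qed.

End jensen.

(** * The extension *)

Section bins.
Context (R : realType).

(** Bin 0 is the tail. The interval ]-M, M[ is cut into 2 M (M + 1) slices of width 1 / (M + 1),
    slice j being bin j + 1, so that a single parameter improves both the truncation and the
    mesh. *)
Definition bin (M k : nat) : set R :=
  if k is j.+1 then
    [set r | `|r| < M%:R /\ j%:R <= (r + M%:R) * M.+1%:R < j.+1%:R]
  else [set r | M%:R <= `|r|].

Lemma measurable_bin M k : measurable (bin M k).
Proof.
case: k => [|j] /=.
  rewrite -[X in measurable X]setTI; apply: measurable_fun_le => //.
rewrite -[X in measurable X]setTI; apply: measurableI => //.
have mlt (f : R -> R) (a : R) : measurable_fun setT f -> measurable [set r : R | f r < a].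
  move=> mf; rewrite (_ : [set r | _] = ~` [set r | a <= f r]).
    apply: measurableC; rewrite -[X in measurable X]setTI; exact: measurable_fun_le.
  by apply/seteqP; split => r /=; rewrite ltNge => /negP.
have m1 : measurable [set r : R | `|r| < M%:R] by exact: mlt.
have mf : measurable_fun setT (fun r : R => (r + M%:R) * M.+1%:R).
  by apply: measurable_funM => //; exact: measurable_funD.
have m2 : measurable [set r : R | j%:R <= (r + M%:R) * M.+1%:R].
  rewrite -[X in measurable X]setTI; apply: measurable_fun_le => //.
have m3 : measurable [set r : R | (r + M%:R) * M.+1%:R < j.+1%:R].
  exact: mlt.
rewrite (_ : [set r | _] = [set r : R | `|r| < M%:R] `&`
  ([set r : R | j%:R <= (r + M%:R) * M.+1%:R] `&` [set r : R | (r + M%:R) * M.+1%:R < j.+1%:R])).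
  by apply: measurableI => //; exact: measurableI.
by apply/seteqP; split => r /=; [move=> [? /andP[]]|move=> [? [? ?]]; split => //; apply/andP].
Qed.

Lemma trivIset_bin M : trivIset setT (bin M).
Proof.
move=> [|i] [|j] _ _ [r [/=]] //.
- by move=> h [h1 _]; move: h; rewrite leNgt h1.
- by move=> [h1 _]; rewrite leNgt h1.
move=> [_ /andP[i1 i2]] [_ /andP[j1 j2]].
have h1 := le_lt_trans i1 j2; have h2 := le_lt_trans j1 i2.
by move: h1 h2; rewrite !ltr_nat !ltnS => h1 h2; congr S; apply/eqP; rewrite eqn_leq h1.
Qed.

Lemma bin_cover M (r : R) : exists2 k, (k < (2 * M * M.+1).+1)%N & bin M k r.
Proof.
have [h|h] := leP M%:R `|r|; first by exists 0%N.
move: (h); rewrite ltr_norml => /andP[h1 h2].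
have M0 : 0 < M.+1%:R :> R by [].
have s0 : 0 <= (r + M%:R) * M.+1%:R by rewrite mulr_ge0//; lra.
have /andP[t1 t2] := truncn_itv s0.
exists (Num.truncn ((r + M%:R) * M.+1%:R)).+1.
  rewrite ltnS -(ltr_nat R) (le_lt_trans t1)// natrM ltr_pM2r// natrM; lra.
by split => //; apply/andP.
Qed.

End bins.

(** * Averages over level sets approximate in modular *)

Section bin_averages.
Context (d : measure_display) (T : measurableType d) (R : realType)
  (P : probability T R) (Phi : R -> R) (hPhi : orlicz_function Phi).
Local Notation q A := (fine (P A)).

Definition bin_avg (M : nat) (X : T -> R) : T -> R :=
  iter_avg P (fun k => X @^-1` @bin R M k) (2 * M * M.+1).+1 X.

Lemma measurable_preimage_bin (X : T -> R) M k : measurable_fun setT X ->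
  measurable (X @^-1` @bin R M k).
Proof.
by move=> mX; rewrite -[X in measurable X]setTI; apply: mX => //; exact: measurable_bin.
Qed.

Lemma trivIset_preimage_bin (X : T -> R) M : trivIset setT (fun k => X @^-1` @bin R M k).
Proof.
by move=> i j _ _ [x [h1 h2]]; apply: (@trivIset_bin R M i j I I); exists (X x).
Qed.

Lemma bin_avg_tail M X x : M%:R <= `|X x| ->
  bin_avg M X x = (\int[P]_(y in [set y | M%:R <= `|X y|]) X y) / q [set y | M%:R <= `|X y|].
Proof.
move=> h; apply: (@iter_avg_disjoint _ _ _ P (fun k => X @^-1` @bin R M k) _ X 0%N) => //.
exact: trivIset_preimage_bin.
Qed.

(** On a slice of positive mass, X and its mean lie in the same interval of length 1 / (M + 1). Null
    slices, where the average is the default 0, form the exceptional set. *)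
Lemma bin_avg_near M X : measurable_fun setT X -> P.-integrable setT (EFin \o X) ->
  {ae P, forall x, `|X x| < M%:R -> `|bin_avg M X x - X x| <= M.+1%:R^-1}.
Proof.
move=> mX iX; pose A k := X @^-1` @bin R M k.
have mA k : measurable (A k) by exact: measurable_preimage_bin.
have tA : trivIset setT A by exact: trivIset_preimage_bin.
pose N k := if q (A k) == 0 then A k else set0.
have negN : P.-negligible (\bigcup_k N k).
  apply: negligible_bigcup => k; rewrite /N; case: ifPn => [/eqP h|_]; last exact: negligible_set0.
  have h' : P (A k) = 0%E by rewrite -(fine_prob P (mA k)) h.
  exact/negligibleP.
apply: negligibleS negN => x /=; apply: contra_notP => nN h.
have [[|k] kn Akx] := bin_cover M (X x); first by move: Akx; rewrite /= leNgt h.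
have qA0 : q (A k.+1) != 0.
  by apply/negP => e; apply: nN; exists k.+1 => //; rewrite /N e.
have qAgt0 : 0 < q (A k.+1) by rewrite lt_neqAle eq_sym qA0 fprob_ge0.
have M0 : 0 < M.+1%:R :> R by [].
rewrite /bin_avg (iter_avg_disjoint P X tA kn Akx).
pose a : R := k%:R / M.+1%:R - M%:R; pose dl : R := M.+1%:R^-1.
have bnd y : A k.+1 y -> a <= X y <= a + dl.
  move=> [_ /andP[b1 b2]]; rewrite -[k.+1%:R]natr1 in b2.
  rewrite /a /dl; apply/andP; split.
    by rewrite lerBlDr ler_pdivrMr.
  have : X y + M%:R <= (k%:R + 1) / M.+1%:R by rewrite ler_pdivlMr// ltW.
  by rewrite mulrDl mul1r -lerBrDr addrAC.
have iA : P.-integrable (A k.+1) (EFin \o X) by exact: integrableS iX.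
have icst (r : R) : P.-integrable (A k.+1) (EFin \o cst r) by exact: finite_measure_integrable_cst.
have l1 : a * q (A k.+1) <= \int[P]_(y in A k.+1) X y.
  rewrite -(Rintegral_cst P (mA k.+1)); apply: le_Rintegral => //; first exact: icst.
  by move=> y /bnd/andP[].
have l2 : \int[P]_(y in A k.+1) X y <= (a + dl) * q (A k.+1).
  rewrite -(Rintegral_cst P (mA k.+1)); apply: le_Rintegral => //; first exact: icst.
  by move=> y /bnd/andP[].
have l1' : a <= (\int[P]_(y in A k.+1) X y) / q (A k.+1) by rewrite ler_pdivlMr.
have l2' : (\int[P]_(y in A k.+1) X y) / q (A k.+1) <= a + dl by rewrite ler_pdivrMr.
have /andP[b1 b2] := bnd x Akx.
rewrite -/dl ler_norml -/(A k.+1); apply/andP; split; lra.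
Qed.

(** Off the tail the error is at most the mesh and contributes Phi s <= e / 2. On the tail, with
    mean c, midpoint convexity separates |c| from |X|, and Jensen's inequality bounds the part of c
    by that of X, itself at most e / 2. *)
Lemma bin_avg_modular (X : T -> R) (l e : R) : measurable_fun setT X ->
  P.-integrable setT (EFin \o X) -> 0 < l ->
  (\int[P]_x (Phi (`|X x| / l))%:E < +oo)%E -> 0 < e ->
  exists M, (\int[P]_x (Phi (`|bin_avg M X x - X x| / (2 * l)))%:E <= e%:E)%E.
Proof.
move=> mX iX l0 Xl e0; have l0' := ltW l0.
have e20 : 0 < e / 2 by rewrite divr_gt0.
have [s s0 se] := orlicz_small hPhi e20.
pose D M := [set y | M%:R <= `|X y|].
have mD M : measurable (D M).
  rewrite -[X in measurable X]setTI; apply: measurable_fun_le => //.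
  exact: measurableT_comp.
pose f x := (Phi (`|X x| / l))%:E.
have f0 x : (0 <= f x)%E by rewrite lee_fin orlicz_norm_ge0.
have mf : measurable_fun setT f by exact: measurable_orliczE.
have iPX : P.-integrable setT f.
  apply/integrableP; split => //.
  by under eq_integral do rewrite gee0_abs//.
have tail : \forall M \near \oo, (\int[P]_x (f \_ (D M)) x < (e / 2)%:E)%E.
  apply: integral_eventually0 iPX _ _ e20 => [M|M x|x].
  - by apply/(measurable_restrictT f (mD M)); exact: measurable_funTS.
  - by rewrite patchE; case: ifPn => _; rewrite ?abse0// gee0_abs.
  - exists (Num.truncn `|X x|).+1 => M mM; rewrite patchE ifF//.
    apply/negP => /set_mem; rewrite /D /= leNgt => /negP; apply.
    by rewrite (lt_le_trans (truncnS_gt _))// ler_nat.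
have mesh : \forall M \near \oo, M.+1%:R^-1 / (2 * l) <= s.
  exists (Num.truncn ((s * (2 * l))^-1)) => // M /= sM.
  have sl0 : 0 < s * (2 * l) by rewrite !mulr_gt0.
  rewrite ler_pdivrMr ?mulr_gt0// invf_ple ?posrE//.
  by rewrite (le_trans (ltW (truncnS_gt _)))// ler_nat ltnS.
have [M [tM sM]] := filter_ex (filterI tail mesh).
exists M.
have mB : measurable_fun setT (bin_avg M X).
  by apply: measurable_iter_avg => // k; exact: measurable_preimage_bin.
pose c := (\int[P]_(y in D M) X y) / q (D M).
pose g x := (((Phi (`|c| / l) + Phi (`|X x| / l)) / 2)%:E : \bar R).
have g0 x : (0 <= g x)%E by rewrite lee_fin divr_ge0// addr_ge0// orlicz_norm_ge0.
have mg : measurable_fun setT g.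
  apply/measurable_EFinP; apply: measurable_funM => //; apply: measurable_funD => //.
  exact: measurable_orlicz.
have mgD : measurable_fun setT (g \_ (D M)).
  by apply/(measurable_restrictT g (mD M)); exact: measurable_funTS.
have gD0 x : (0 <= (g \_ (D M)) x)%E by rewrite patchE; case: ifPn.
have Ps0 : 0 <= Phi s by rewrite orlicz_ge0// ltW.
apply: (@le_trans _ _ (\int[P]_x ((Phi s)%:E + (g \_ (D M)) x))%E).
  apply: ae_ge0_le_integral => //.
  - by move=> x _; rewrite lee_fin orlicz_norm_ge0// mulr_ge0.
  - apply: measurable_orliczE => //; first by rewrite mulr_ge0.
    exact: measurable_funB.
  - by move=> x _; rewrite adde_ge0.
  - exact: emeasurable_funD.
  apply: filterS (bin_avg_near M mX iX) => x near_x _; rewrite patchE; case: ifPn => [/set_mem Dx|nD].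
    rewrite bin_avg_tail// -/(D M) -/c -EFinD lee_fin.
    apply: (@le_trans _ _ ((Phi (`|c| / l) + Phi (`|X x| / l)) / 2)); last by rewrite lerDr.
    apply: le_trans (orlicz_mean2 hPhi _ _); rewrite ?divr_ge0//.
    apply: orlicz_le => //; first by rewrite divr_ge0// mulr_ge0.
    have -> : (`|c| / l + `|X x| / l) / 2 = (`|c| + `|X x|) / (2 * l).
      by field; rewrite gt_eqF.
    by rewrite ler_pM2r ?invr_gt0 ?mulr_gt0// ler_normB.
  rewrite adde0 lee_fin orlicz_le// ?divr_ge0 ?mulr_ge0//.
  apply: le_trans sM; rewrite ler_pM2r ?invr_gt0 ?mulr_gt0//; apply: near_x.
  by rewrite ltNge; apply/negP => h; move/negP : nD; apply; apply/mem_set.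
rewrite ge0_integralD//.
rewrite integral_cst//= probability_setT mule1.
rewrite (_ : e%:E = (e / 2)%:E + (e / 2)%:E)%E; last by rewrite -EFinD; congr (_%:E); lra.
apply: leeD; first by rewrite lee_fin.
rewrite -integral_mkcond.
have -> : (\int[P]_(x in D M) g x = 2^-1%:E * \int[P]_(x in D M) ((Phi (`|c| / l))%:E + f x))%E.
  rewrite -ge0_integralZl_EFin//; last 2 first.
  - by move=> x _; rewrite adde_ge0// lee_fin orlicz_norm_ge0.
  - by apply: emeasurable_funD => //; exact: measurable_funTS.
  by apply: eq_integral => x _; rewrite /g /f -EFinD -EFinM mulrC.
rewrite ge0_integralD//; last 2 first.
- by move=> x _; rewrite lee_fin orlicz_norm_ge0.
- exact: measurable_funTS.
rewrite integral_cst//.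
have tM' : (\int[P]_(x in D M) f x <= (e / 2)%:E)%E by rewrite integral_mkcond ltW.
have J := orlicz_jensen hPhi (mD M) iX l0; rewrite -/c in J.
apply: (@le_trans _ _ (2^-1%:E * ((e / 2)%:E + (e / 2)%:E))%E); last first.
  by rewrite -EFinD -EFinM lee_fin; lra.
rewrite lee_wpmul2l ?lee_fin ?invr_ge0//; apply: leeD => //.
by apply: le_trans tM'; apply: le_trans J; rewrite EFinM (fine_prob P (mD M)).
Qed.

Lemma bin_avg_approx (X : T -> R) : LPhi P Phi X ->
  exists M : nat -> nat,
    {ae P, forall x, (fun n => bin_avg (M n) X x) @ \oo --> X x} /\
    exists Y, LPhi P Phi Y /\ forall n, {ae P, forall x, `|bin_avg (M n) X x| <= Y x}.
Proof.
move=> LX; have [mX [l [l0 Xl]]] := LX.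
have Xly : (\int[P]_x (Phi (`|X x| / l))%:E < +oo)%E by rewrite (le_lt_trans Xl)// ltry.
have H n : exists M,
   (\int[P]_x (Phi (`|bin_avg M X x - X x| / (2 * l)))%:E <= (1 / (2 ^ n.+1)%:R)%:E)%E.
  have e0 : 0 < 1 / (2 ^ n.+1)%:R :> R by rewrite divr_gt0// ltr0n expn_gt0.
  exact: (bin_avg_modular mX (LPhi_integrable hPhi LX) l0 Xly e0).
have [M MP] := choice H; exists M.
apply: (modular_dominated_cvg hPhi (l := 2 * l)) => // [|n].
  by rewrite mulr_gt0.
by apply: measurable_iter_avg => // k; exact: measurable_preimage_bin.
Qed.

End bin_averages.

Section extension.
Context (d : measure_display) (T : measurableType d) (R : realType)
  (P : probability T R) (Phi : R -> R) (hPhi : orlicz_function Phi).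
Implicit Types (X Y : T -> R) (A : nat -> set T).
Variables (rho : (T -> R) -> \bar R) (naP : nonatomic P).

(** The families of cells do not depend on X, so for each of them the averaging operator is linear,
    and convexity and the Fatou property pass to the supremum. The covering condition makes the
    averages bounded, where [rho] is given. *)
Definition avg_sup X : \bar R :=
  ereal_sup [set z | exists A n, [/\ forall k, measurable (A k), covers A n &
                                     z = rho (iter_avg P A n X)]].

Lemma avg_sup_ge A n X : (forall k, measurable (A k)) -> covers A n ->
  (rho (iter_avg P A n X) <= avg_sup X)%E.
Proof. by move=> mA cA; apply: ereal_sup_ubound; exists A, n. Qed.

Lemma avg_sup_ge_bin M X : measurable_fun setT X ->
  (rho (bin_avg P M X) <= avg_sup X)%E.
Proof.
move=> mX; apply: avg_sup_ge => [k|x]; first exact: measurable_preimage_bin.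
exact: bin_cover.
Qed.

Lemma covers_Linfty A n X : (forall k, measurable (A k)) -> covers A n ->
  P.-integrable setT (EFin \o X) -> Linfty P (iter_avg P A n X).
Proof.
move=> mA cA iX; split.
  by apply: measurable_iter_avg => //; apply/measurable_EFinP; exact: measurable_int iX.
have [C C0 HC] := iter_avg_bound P n mA; exists (C * \int[P]_x `|X x|).
by apply: aeW => x; have [k kn Akx] := cA x; exact: (HC X iX x k).
Qed.

Lemma iter_avg_Linfty A n X : (forall k, measurable (A k)) -> Linfty P X ->
  Linfty P (iter_avg P A n X).
Proof. by move=> mA LX; elim: n => //= n IH; exact: (Linfty_cellavg hPhi). Qed.

Lemma iter_avg_bounded A n X c : (forall k, measurable (A k)) -> measurable_fun setT X ->
  {ae P, forall x, `|X x| <= c} -> {ae P, forall x, `|iter_avg P A n X x| <= c}.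
Proof.
move=> mA mX Xc; elim: n => //= n IH; apply: (bounded_cellavg hPhi) => //.
exact: measurable_iter_avg.
Qed.

Lemma Linfty_cst (c : R) : Linfty P (cst c).
Proof. by split; [exact: measurable_cst|exists `|c|; apply: aeW]. Qed.

Lemma bin_avg_Linfty M X : P.-integrable setT (EFin \o X) -> Linfty P (bin_avg P M X).
Proof.
move=> iX; have mX : measurable_fun setT X.
  by apply/measurable_EFinP; exact: measurable_int iX.
apply: covers_Linfty => // [k|x]; first exact: measurable_preimage_bin.
exact: bin_cover.
Qed.

Hypotheses (prho : proper_on (Linfty P) rho) (crho : convex_on (Linfty P) rho)
  (lrho : law_invariant_on P (Linfty P) rho) (frho : fatou_on P (Linfty P) rho).

(** One inequality is dilatation monotonicity, applied cell by cell. The other is the Fatou property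
    of [rho] along bin averages, which keep the essential bound c of X. *)
Lemma avg_sup_extends X : Linfty P X -> avg_sup X = rho X.
Proof.
move=> LX; have [mX [c Xc]] := LX; apply/eqP; rewrite eq_le; apply/andP; split.
  apply: ge_ereal_sup => _ [A [n [mA _ ->]]].
  elim: n => [|n IH] //=; apply: le_trans IH.
  by apply: (dilatation_Linfty hPhi) => //; exact: iter_avg_Linfty.
have [M [Mcvg _]] := bin_avg_approx hPhi (Linfty_LPhi hPhi LX).
have iX := LPhi_integrable hPhi (Linfty_LPhi hPhi LX).
have mbin (n k : nat) : measurable (X @^-1` @bin R (M n) k) by exact: measurable_preimage_bin.
apply: le_trans (frho (Xn := fun n => bin_avg P (M n) X) (Y := cst c) _ LX (Linfty_cst c) Mcvg _) _.
- by move=> n; exact: bin_avg_Linfty.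
- by move=> n; apply: iter_avg_bounded.
by apply: limn_einf_le => n; exact: avg_sup_ge_bin.
Qed.

Lemma avg_sup_neqNy X : LPhi P Phi X -> avg_sup X != -oo%E.
Proof.
move=> LX; have mX : measurable_fun setT X by case: LX.
(* For M = 0 the single cell is the whole space, and the lower bound is [rho] at the constant
   expectation of X. *)
rewrite -ltNye; apply: lt_le_trans (avg_sup_ge_bin 0 mX).
rewrite ltNye; have [+ _] := prho; apply; apply: bin_avg_Linfty.
exact: LPhi_integrable LX.
Qed.

Lemma avg_sup_proper : proper_on (LPhi P Phi) avg_sup.
Proof.
split; first exact: avg_sup_neqNy.
have [_ [X [LX Xy]]] := prho; exists X; split; first exact: Linfty_LPhi.
by rewrite avg_sup_extends.
Qed.

Lemma avg_sup_convex : convex_on (LPhi P Phi) avg_sup.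
Proof.
move=> X Y l LX LY l01; have /andP[l0 l1] := l01.
apply: ge_ereal_sup => _ [A [n [mA cA ->]]].
have iX := LPhi_integrable hPhi LX; have iY := LPhi_integrable hPhi LY.
rewrite iter_avg_lin//; apply: le_trans (crho _ _ l01) _; try exact: covers_Linfty.
by apply: leeD; apply: lee_wpmul2l; rewrite ?lee_fin ?subr_ge0//; exact: avg_sup_ge.
Qed.

(** For fixed cells, dominated convergence in L^1 becomes uniform convergence of the averages with
    the uniform bound K, to which the Fatou property of [rho] applies; each average is below the
    supremum. *)
Lemma avg_sup_fatou : fatou_on P (LPhi P Phi) avg_sup.
Proof.
move=> Xn X Y LXn LX LY Xcvg XY.
have iXn n := LPhi_integrable hPhi (LXn n).
have iX := LPhi_integrable hPhi LX; have iY := LPhi_integrable hPhi LY.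
apply: ge_ereal_sup => _ [A [n [mA cA ->]]].
have [C C0 HC] := iter_avg_bound P n mA.
have bound Z x : P.-integrable setT (EFin \o Z) -> `|iter_avg P A n Z x| <= C * \int[P]_x `|Z x|.
  by move=> iZ; have [k kn Akx] := cA x; exact: (HC Z iZ x k).
have mE Z : P.-integrable setT (EFin \o Z) -> measurable_fun setT (EFin \o Z).
  exact: measurable_int.
have L1cvg : \int[P]_x `|Xn m x - X x| @[m --> \oo] --> 0.
  have H1 : {ae P, forall x, setT x -> (fun m => (EFin \o Xn m) x) @ \oo --> (EFin \o X) x}.
    by apply: filterS Xcvg => x h _; apply: cvg_EFin; [exact: nearW|exact: h].
  have H2 : {ae P, forall x m, setT x -> (`|(EFin \o Xn m) x| <= (EFin \o Y) x)%E}.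
    apply/ae_foralln => m.
    by apply: filterS (XY m) => x h _; rewrite /= lee_fin.
  have [_ D _] := dominated_convergence measurableT (fun m => mE _ (iXn m)) (mE _ iX) H1 iY H2.
  exact: (fine_cvg D).
have ncvg x : iter_avg P A n (Xn m) x @[m --> \oo] --> iter_avg P A n X x.
  apply/cvgrPdist_lt => e e0.
  (* [C] may be 0, so C + 1 is used as divisor of e. *)
  have C1 : 0 < C + 1 by lra.
  move/cvgr0Pnorm_lt : L1cvg => /(_ _ (divr_gt0 e0 C1)); apply: filterS => m hm.
  have I0 : 0 <= \int[P]_x `|Xn m x - X x| by apply: Rintegral_ge0 => y _; exact: normr_ge0.
  rewrite ger0_norm// ltr_pdivlMr// in hm.
  have -> : `|iter_avg P A n X x - iter_avg P A n (Xn m) x| =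
      `|iter_avg P A n (fun y => 1 * Xn m y + (-1) * X y) x|.
    by rewrite iter_avg_lin// mul1r mulN1r distrC.
  have sub : (fun y => 1 * Xn m y + (-1) * X y) = (fun y => Xn m y - X y).
    by apply/funext => y; rewrite mul1r mulN1r.
  have iD : P.-integrable setT (EFin \o (fun y => Xn m y - X y)).
    by apply: (@integrableB _ _ _ _ _ measurableT _ _ (iXn m) iX).
  by rewrite sub; apply: le_lt_trans (bound _ x iD) _; lra.
pose K := C * \int[P]_x `|Y x|.
apply: le_trans (frho (Xn := fun m => iter_avg P A n (Xn m)) (Y := cst K) _ _ (Linfty_cst K) _ _) _.
- by move=> m; exact: covers_Linfty.
- exact: covers_Linfty.
- by apply: aeW => x; exact: ncvg.
- move=> m; apply: aeW => x; apply: le_trans (bound _ x (iXn m)) _.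
  rewrite ler_wpM2l// -lee_fin !fineK; last 2 first.
  + have : P.-integrable setT (EFin \o (fun x => `|Y x|)) by exact: integrable_norm.
    exact: integrable_fin_num.
  + have : P.-integrable setT (EFin \o (fun x => `|Xn m x|)) by exact: integrable_norm.
    exact: integrable_fin_num.
  have m1 Z : P.-integrable setT (EFin \o Z) -> measurable_fun setT (fun x => `|Z x|%:E).
    by move=> iZ; exact: measurable_int (integrable_norm iZ).
  apply: ae_ge0_le_integral => //; [exact: m1|exact: m1|].
  apply: filterS (XY m) => y h _; rewrite lee_fin (le_trans h)// ler_norm //.
by apply: le_limn_einf => m; exact: avg_sup_ge.
Qed.

(** Bin averages of X and of Y are the same function g of X and of Y, hence have equal law and equal
    [rho]. The Fatou property along those of X gives the inequality; exchanging X and Y gives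
    equality. *)
Lemma avg_sup_law_le X Y : LPhi P Phi X -> LPhi P Phi Y -> same_law P X Y ->
  (avg_sup X <= avg_sup Y)%E.
Proof.
move=> LX LY XY; have mX : measurable_fun setT X by case: LX.
have mY : measurable_fun setT Y by case: LY.
have iX := LPhi_integrable hPhi LX; have iY := LPhi_integrable hPhi LY.
have [M [Mcvg [Z [LZ MZ]]]] := bin_avg_approx hPhi LX.
apply: le_trans (avg_sup_fatou (Xn := fun n => bin_avg P (M n) X) _ LX LZ Mcvg MZ) _.
  by move=> n; apply: Linfty_LPhi => //; exact: bin_avg_Linfty.
apply: limn_einf_le => n; rewrite avg_sup_extends; last exact: bin_avg_Linfty.
apply: le_trans (avg_sup_ge_bin (M n) mY).
have [g [mg gX gY]] := iter_avg_same_law (2 * M n * (M n).+1).+1 (@measurable_bin R (M n)) mX mY XY.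
have gXY : same_law P (g \o X) (g \o Y).
  move=> B mB; apply: (XY (g @^-1` B)).
  by rewrite -[X in measurable X]setTI; exact: mg.
have eX : bin_avg P (M n) X = g \o X := gX.
have eY : bin_avg P (M n) Y = g \o Y := gY.
have LbX : Linfty P (bin_avg P (M n) X) by exact: bin_avg_Linfty.
have LbY : Linfty P (bin_avg P (M n) Y) by exact: bin_avg_Linfty.
rewrite eX in LbX *; rewrite eY in LbY *.
by rewrite (lrho LbX LbY gXY).
Qed.

(** Bin averages and the Fatou property of [rho''] give the upper bound, dilatation monotonicity of
    [rho''] on L^Phi the lower one; both compare values at bounded averages, where [rho''] is
    [rho]. *)
Lemma avg_sup_unique (rho'' : (T -> R) -> \bar R) :
  (forall X, Linfty P X -> rho'' X = rho X) ->
  proper_on (LPhi P Phi) rho'' -> convex_on (LPhi P Phi) rho'' ->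
  law_invariant_on P (LPhi P Phi) rho'' -> fatou_on P (LPhi P Phi) rho'' ->
  forall X, LPhi P Phi X -> rho'' X = avg_sup X.
Proof.
move=> ext pr cr lr fr X LX; have mX : measurable_fun setT X by case: LX.
have iX := LPhi_integrable hPhi LX.
apply/eqP; rewrite eq_le; apply/andP; split.
  have [M [Mcvg [Z [LZ MZ]]]] := bin_avg_approx hPhi LX.
  apply: le_trans (fr (fun n => bin_avg P (M n) X) _ _ _ LX LZ Mcvg MZ) _.
    by move=> n; apply: Linfty_LPhi => //; exact: bin_avg_Linfty.
  apply: limn_einf_le => n; rewrite ext; last exact: bin_avg_Linfty.
  exact: avg_sup_ge_bin.
apply: ge_ereal_sup => _ [A [n [mA cA ->]]].
rewrite -ext; last exact: covers_Linfty.
have : LPhi P Phi (iter_avg P A n X) /\ (rho'' (iter_avg P A n X) <= rho'' X)%E; last by case.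
elim: n {cA} => [|n [IH1 IH2]] //=; split; first exact: LPhi_cellavg.
by apply: le_trans IH2; apply: (dilatation_LPhi hPhi).
Qed.

End extension.

Theorem theorem4 (d : measure_display) (T : measurableType d) (R : realType)
    (P : probability T R) (Phi : R -> R)
    (rho : (T -> R) -> \bar R) :
  nonatomic P ->
  orlicz_function Phi -> orlicz_superlinear Phi ->
  proper_on (Linfty P) rho ->
  convex_on (Linfty P) rho ->
  law_invariant_on P (Linfty P) rho ->
  fatou_on P (Linfty P) rho ->
  exists rho' : (T -> R) -> \bar R,
    [/\ (forall X, Linfty P X -> rho' X = rho X),
        proper_on (LPhi P Phi) rho',
        convex_on (LPhi P Phi) rho',
        law_invariant_on P (LPhi P Phi) rho' &
        fatou_on P (LPhi P Phi) rho' ] /\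
        (forall rho'' : (T -> R) -> \bar R,
           (forall X, Linfty P X -> rho'' X = rho X) ->
           proper_on (LPhi P Phi) rho'' ->
           convex_on (LPhi P Phi) rho'' ->
           law_invariant_on P (LPhi P Phi) rho'' ->
           fatou_on P (LPhi P Phi) rho'' ->
           forall X, LPhi P Phi X -> rho'' X = rho' X).
Proof.
move=> naP hPhi _ prho crho lrho frho.
exists (avg_sup P rho); split; last exact: (avg_sup_unique hPhi naP).
split.
- exact: (avg_sup_extends hPhi naP prho crho lrho frho).
- exact: (avg_sup_proper hPhi naP prho crho lrho frho).
- exact: (avg_sup_convex hPhi crho).
- move=> X Y LX LY XY; apply/eqP; rewrite eq_le.
  rewrite (avg_sup_law_le hPhi naP prho crho lrho frho LX LY XY).
  by rewrite (avg_sup_law_le hPhi naP prho crho lrho frho LY LX (same_law_sym XY)).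
- exact: (avg_sup_fatou hPhi frho).
Qed.
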